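(* Let $E$ be a natural quasi-Banach space. Then $\mathrm{FQBL}^{(L)}[E]$ is $p$-convex for every $p\in(0,p_E)$.
   Context: All spaces are real; operators are continuous linear maps. For $s\in(0,1]$, an $s$-norm satisfies $\|e+e'\|^s\le\|e\|^s+\|e'\|^s$ (besides definiteness and homogeneity); a quasi-norm satisfies $\|e+e'\|\le\Delta(\|e\|+\|e'\|)$ for some $\Delta\ge1$. Complete $s$-normed (quasi-normed) spaces are $s$-Banach (quasi-Banach) spaces; those which are also vector lattices with $|x|\le|y|\Rightarrow\|x\|\le\|y\|$ are $s$-Banach (quasi-Banach) lattices. A quasi-Banach lattice $X$ is $s$-convex ($0<s<\infty$) if there is $C>0$ with $\|(\sum_{k=1}^n|x_k|^s)^{1/s}\|\le C(\sum_{k=1}^n\|x_k\|^s)^{1/s}$ for all finite families in $X$; the infimum of such $C$ is $M^{(s)}(X)$. $X$ is $L$-convex if there is $\varepsilon\in(0,1)$ such that whenever $u\in X_+$, $\|u\|=1$ and $x_1,\dots,x_n\in[0,u]$ satisfy $\frac1n\sum_k x_k\ge(1-\varepsilon)u$, then $\max_k\|x_k\|\ge\varepsilon$; by a theorem of Kalton this is equivalent to $X$ being $s$-convex for some $s>0$. For an $L$-convex $X$ put $M^{(L)}(X)=\inf\{M^{(s)}(X): X\text{ is }s\text{-convex}\}$. A quasi-Banach space $E$ is $s$-natural ($0<s\le1$) if it embeds linearly and isometrically into an $s$-convex $s$-Banach lattice $X$ with $M^{(s)}(X)=1$; $E$ is natural if it is $s$-natural for some $s\in(0,1]$. For natural $E$,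 $p_E=\sup\{s\in(0,1): E\text{ is }s\text{-natural}\}$. The free $L$-convex quasi-Banach lattice generated by a natural $E$ is an $L$-convex quasi-Banach lattice $\mathrm{FQBL}^{(L)}[E]$ with $M^{(L)}(\mathrm{FQBL}^{(L)}[E])=1$ together with a linear isometric embedding $\delta:E\to\mathrm{FQBL}^{(L)}[E]$ such that for every operator $T:E\to X$ into an $L$-convex quasi-Banach lattice $X$ there is a unique lattice homomorphism $\widehat T:\mathrm{FQBL}^{(L)}[E]\to X$ with $\widehat T\delta=T$, and $\|\widehat T\|\le M^{(L)}(X)\|T\|$ (it exists for every natural $E$). *)

(* Defs.v *)
From HB Require Import structures.
From mathcomp Require Import all_boot all_order all_algebra.
From mathcomp Require Import all_classical all_reals all_analysis.

Set Implicit Arguments.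
Unset Strict Implicit.
Unset Printing Implicit Defensive.

Import Order.TTheory GRing.Theory Num.Theory.
Import numFieldNormedType.Exports.

Local Open Scope classical_set_scope.
Local Open Scope ring_scope.

(* The norm of [normedModType] satisfies the triangle inequality, so
   quasi-norms get their own structure, with norm function [qnorm]. *)
HB.mixin Record isQuasiBanach (R : realType) V of GRing.Lmodule R V := {
  qnorm : V -> R ;
  qnorm_ge0 : forall x : V, 0 <= qnorm x ;
  qnorm_eq0 : forall x : V, qnorm x = 0 -> x = 0 ;
  qnormZ : forall (a : R) (x : V), qnorm (a *: x) = `|a| * qnorm x ;
  qnormD : exists2 D : R, 1 <= D &
    forall x y : V, qnorm (x + y) <= D * (qnorm x + qnorm y) ;
  qnorm_complete : forall u : nat -> V,
    (forall e : R, 0 < e -> exists N : nat, forall m n : nat,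
       (N <= m)%N -> (N <= n)%N -> qnorm (u m - u n) < e) ->
    exists l : V, forall e : R, 0 < e -> exists N : nat, forall n : nat,
       (N <= n)%N -> qnorm (u n - l) < e
}.

#[short(type="quasiBanachType")]
HB.structure Definition QuasiBanach (R : realType) :=
  {V of GRing.Lmodule R V & isQuasiBanach R V}.

(* [Order.Lattice] cannot be joined with [GRing.Lmodule] downstream of
   [Num.RealDomain], hence the lattice operations are fields here. *)
HB.mixin Record isVectorLattice (R : realType) V
    of GRing.Lmodule R V & Num.POrderedZmodule V := {
  vlat_lerD : forall x y z : V, x <= y -> x + z <= y + z ;
  vlat_scaler_ge0 : forall (a : R) (x : V), 0 <= a -> 0 <= x -> 0 <= a *: x ;
  vjoin : V -> V -> V ;
  vmeet : V -> V -> V ;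
  vjoin_le : forall x y z : V, (vjoin x y <= z) = (x <= z) && (y <= z) ;
  vmeet_ge : forall x y z : V, (z <= vmeet x y) = (z <= x) && (z <= y)
}.

#[short(type="vectorLatticeType")]
HB.structure Definition VectorLattice (R : realType) :=
  {V of GRing.Lmodule R V & Num.POrderedZmodule V & isVectorLattice R V}.

Definition labs (R : realType) (V : vectorLatticeType R) (x : V) : V :=
  vjoin x (- x).

HB.mixin Record isLatticeQuasiNorm (R : realType) V
    of QuasiBanach R V & VectorLattice R V := {
  qnorm_mono : forall x y : V, labs x <= labs y -> qnorm x <= qnorm y
}.

#[short(type="quasiBanachLatticeType")]
HB.structure Definition QuasiBanachLattice (R : realType) :=
  {V of QuasiBanach R V & VectorLattice R V & isLatticeQuasiNorm R V}.

Section Operators.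
Context {R : realType}.

(* Balls of a quasi-norm need not be open, but those centred at [x] form a
   neighbourhood base at [x]: this is continuity for the induced topology. *)
Definition qcontinuous (E F : quasiBanachType R) (T : E -> F) : Prop :=
  forall (x : E) (e : R), 0 < e -> exists2 d : R, 0 < d &
    forall y : E, qnorm (y - x) < d -> qnorm (T y - T x) < e.

Definition opnorm (E F : quasiBanachType R) (T : E -> F) : R :=
  sup [set qnorm (T x) | x in [set x : E | qnorm x <= 1]].

Definition isometric (E F : quasiBanachType R) (T : E -> F) : Prop :=
  forall x : E, qnorm (T x) = qnorm x.

Definition lattice_hom (X Y : quasiBanachLatticeType R)
    (T : {linear X -> Y}) : Prop :=
  [/\ qcontinuous T,
      (forall x y : X, T (vjoin x y) = vjoin (T x) (T y)) &
      (forall x y : X, T (vmeet x y) = vmeet (T x) (T y))].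

(* [s]-Banach spaces are the quasi-Banach spaces satisfying [is_snorm s]
   (an [s]-norm is a quasi-norm with constant [2 `^ (s^-1 - 1)]). *)
Definition is_snorm (s : R) (E : quasiBanachType R) : Prop :=
  forall x y : E, qnorm (x + y) `^ s <= qnorm x `^ s + qnorm y `^ s.

End Operators.

Section Convexity.
Context {R : realType}.

Definition pos_homogeneous n (h : 'rV[R]_n -> R) : Prop :=
  forall (a : R) (t : 'rV[R]_n), 0 <= a -> h (a *: t) = a * h t.

Definition krivine_fun n : set ('rV[R]_n -> R) :=
  [set h | continuous h /\ pos_homogeneous h].

(* [Phi] is the Krivine functional calculus of [x_1, ..., x_n], that is, the
   linear lattice homomorphism on the continuous positively homogeneous
   functions on R^n sending the i-th coordinate to [x_i]. It exists and is
   unique in every quasi-Banach lattice; the values of [Phi] outside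
   [krivine_fun n] are irrelevant. [Phi h] is what is usually written
   [h(x_1, ..., x_n)]. *)
Definition krivine_calculus (X : quasiBanachLatticeType R) n (x : 'I_n -> X)
    (Phi : ('rV[R]_n -> R) -> X) : Prop :=
  [/\ (forall i : 'I_n, Phi (fun t => t ord0 i) = x i),
      (forall (a : R) g h, krivine_fun g -> krivine_fun h ->
         Phi (fun t => a * g t + h t) = a *: Phi g + Phi h),
      (forall g h, krivine_fun g -> krivine_fun h ->
         Phi (fun t => Num.max (g t) (h t)) = vjoin (Phi g) (Phi h)) &
      (forall g h, krivine_fun g -> krivine_fun h ->
         Phi (fun t => Num.min (g t) (h t)) = vmeet (Phi g) (Phi h))].

Definition lp_fun (s : R) n (t : 'rV[R]_n) : R :=
  (\sum_(k < n) `|t ord0 k| `^ s) `^ s^-1.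

Definition convexity_constant (s : R) (X : quasiBanachLatticeType R) : set R :=
  [set C | 0 < C /\
    forall n (x : 'I_n -> X) (Phi : ('rV[R]_n -> R) -> X),
      krivine_calculus x Phi ->
      qnorm (Phi (@lp_fun s n)) <=
        C * (\sum_(k < n) qnorm (x k) `^ s) `^ s^-1].

Definition s_convex (s : R) (X : quasiBanachLatticeType R) : Prop :=
  0 < s /\ exists C, convexity_constant s X C.

Definition M_s (s : R) (X : quasiBanachLatticeType R) : R :=
  inf (convexity_constant s X).

Definition L_convex (X : quasiBanachLatticeType R) : Prop :=
  exists2 eps : R, 0 < eps < 1 &
    forall (u : X) n (x : 'I_n.+1 -> X),
      0 <= u -> qnorm u = 1 ->
      (forall k, 0 <= x k /\ x k <= u) ->
      (1 - eps) *: u <= n.+1%:R^-1 *: \sum_(k < n.+1) x k ->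
      eps <= \big[Num.max/0]_(k < n.+1) qnorm (x k).

Definition M_L (X : quasiBanachLatticeType R) : R :=
  inf [set M_s s X | s in [set s : R | s_convex s X]].

Definition s_natural (s : R) (E : quasiBanachType R) : Prop :=
  0 < s <= 1 /\
  exists (X : quasiBanachLatticeType R) (J : {linear E -> X}),
    [/\ is_snorm s X, s_convex s X, M_s s X = 1 & isometric J].

Definition natural (E : quasiBanachType R) : Prop :=
  exists s : R, s_natural s E.

Definition p_nat (E : quasiBanachType R) : R :=
  sup [set s : R | 0 < s < 1 /\ s_natural s E].

Definition is_FQBL (E : quasiBanachType R) (F : quasiBanachLatticeType R)
    (delta : {linear E -> F}) : Prop :=
  [/\ L_convex F, M_L F = 1, isometric delta &
    forall (X : quasiBanachLatticeType R) (T : {linear E -> X}),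
      L_convex X -> qcontinuous T ->
      exists That : {linear F -> X},
        [/\ lattice_hom That,
            (forall e : E, That (delta e) = T e),
            (forall S : {linear F -> X}, lattice_hom S ->
               (forall e : E, S (delta e) = T e) -> forall f, S f = That f) &
            opnorm That <= M_L X * opnorm T]].

End Convexity.

(* Main.v *)
Require Import Defs.
From HB Require Import structures.
From mathcomp Require Import all_boot all_order all_algebra.
From mathcomp Require Import all_classical all_reals all_analysis.
From mathcomp Require Import lra ring.
Import Order.TTheory GRing.Theory Num.Theory.
Import numFieldNormedType.Exports.
Local Open Scope classical_set_scope.
Local Open Scope ring_scope.

Set Implicit Arguments.
Unset Strict Implicit.
Unset Printing Implicit Defensive.

(** The lattice F freely generated by E is p-convex because its quasi-norm is
    equivalent to a p-convex one, built from delta.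

    Fix p below p_E. Then E embeds isometrically into an s-Banach lattice for
    some s > p, so that E itself is s-normed; only this property of E enters
    the estimates. Say that f in F lies in the ball of size rho when, up to
    an arbitrarily small error in F, it satisfies |f|^p <= sum |delta x_i|^p
    for finitely many x_i in E with sum ||x_i||^p <= rho ([power_ball]). The
    gauge of these balls turns the elements of finite gauge into an ideal G
    of F ([power_space]), complete for the p-norm given by the gauge and
    L-convex ([power_space_L_convex]), and delta corestricts to a contraction from E
    to G. The universal property extends the latter to a lattice homomorphism
    T from F to G, and uniqueness of extensions makes the inclusion of G
    composed with T the identity of F. So every f in F has gauge at most
    C ||f||^p, and p-convexity of F can be read off from the definition of
    the balls.

    The main estimate is that the ball of size 1 is bounded in F
    ([power_ball_bounded]), which says that delta is a p-convex operator. It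
    is a factorization argument in the spirit of Nikishin and Maurey. Given
    vectors y_i of the unit ball of E with |f|^p at most the average of the
    |delta y_i|^p, draw indices w(1), ..., w(m) and integers U(l) below N
    uniformly, and consider z = sum_l U(l) l^(-1/p) y_(w(l)). On the one hand
    ||z||^s is at most N^s times the sum of the l^(-s/p), which converges as
    s > p. On the other hand, at each real point of F, a fixed multiple of
    |delta z| exceeds |f| with probability close to 1: very likely some term
    is large ([pick_rare]), and the random integer in front of it is unlikely
    to be cancelled by the other terms ([dither_mean]). Hence the minima of
    |f| and of that multiple of |delta z| average to at least (1 - eps) |f|.
    L-convexity is precisely the statement that |f| is then bounded by a
    multiple of the bound on these minima ([L_convex_mean]).

    Inequalities between real numbers are transferred to F by evaluating at
    lattice homomorphisms from principal ideals of F to the reals. By Yosida's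
    theorem these detect the order of an archimedean vector lattice
    ([points_le]). Powers of elements of F are thus only ever compared after
    evaluation, and the same goes for the Krivine calculus
    ([krivine_lp_le]). *)

(** * Inequalities for real powers *)

Section ScalarInequalities.
Context {R : realType}.
Implicit Types p x y t v : R.

(** Concavity of the power, in the form of the weighted inequality between
    arithmetic and geometric means of [x] and 1. *)
Lemma powR_le_tangent p x : 0 <= p <= 1 -> 0 <= x -> x `^ p <= 1 + p * (x - 1).
Proof.
move=> /andP[p0 p1]; rewrite le_eqVlt => /predU1P[<-|x0].
  by rewrite /powR eqxx; case: eqP => /= [->|_]; lra.
rewrite /powR gt_eqF//; set g := expR (p * ln x).
have g0 : 0 < g by apply: expR_gt0.
have e1 : g * (1 + (1 - p) * ln x) <= x.
  rewrite -[leRHS]lnK// (_ : ln x = p * ln x + (1 - p) * ln x); last by ring.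
  by rewrite expRD ler_wpM2l ?(ltW g0)// (le_trans _ (expR_ge1Dx _))//; lra.
have e2 : g * (1 + - (p * ln x)) <= 1.
  rewrite -[leRHS](@expR0 R) -[X in _ <= expR X](subrr (p * ln x)) expRD.
  by rewrite ler_wpM2l ?expR_ge1Dx ?(ltW g0).
have p1' : 0 <= 1 - p by lra.
have := lerD (ler_wpM2l p0 e1) (ler_wpM2l p1' e2).
by rewrite [leLHS](_ : _ = g); [lra|ring].
Qed.

(** The graph of a concave power lies above its chords from the origin. *)
Lemma powR_chord p t v : 0 < p <= 1 -> 0 <= t <= v -> v `^ p * (t / v) <= t `^ p.
Proof.
move=> /andP[p0 p1] /andP[t0 tv]; have [->|tn0] := eqVneq t 0.
  by rewrite mul0r mulr0 powR_ge0.
have tgt0 : 0 < t by rewrite lt_neqAle eq_sym tn0.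
have v0 : 0 < v := lt_le_trans tgt0 tv.
have vn0 : v != 0 by rewrite gt_eqF.
rewrite -[in leRHS](mulfVK vn0 t) mulrC (powRM _ _ (ltW v0)).
  by rewrite ler_wpM2r ?powR_ge0// ger1_powR// divr_gt0 ?ler_pdivrMr ?mul1r.
by rewrite divr_ge0 // ltW.
Qed.

Lemma powRD_le p x y : 0 < p <= 1 -> 0 <= x -> 0 <= y ->
  (x + y) `^ p <= x `^ p + y `^ p.
Proof.
move=> p01 x0 y0; have [w0|w0] := eqVneq (x + y) 0.
  by rewrite w0 powR0 ?addr_ge0 ?powR_ge0//; case/andP: p01 => /gt_eqF->.
have /(powR_chord p01) hx : 0 <= x <= x + y by rewrite x0 lerDl.
have /(powR_chord p01) hy : 0 <= y <= x + y by rewrite y0 lerDr.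
by apply: le_trans (lerD hx hy); rewrite -mulrDr -mulrDl divff ?mulr1.
Qed.

(** The discrete form of the fact that [x `^ (- p)] has derivative
    [- p * x `^ (- (1 + p))]; it makes Riemann sums telescope. *)
Lemma powR_shift_sub p (w : R) : 0 < p <= 1 -> 1 < w ->
  p * w `^ (- (1 + p)) <= (w - 1) `^ (- p) - w `^ (- p).
Proof.
move=> /andP[p0 p1] w1; have w0 : 0 < w by lra.
have w10 : 0 < w - 1 by lra.
have A : 0 < (w - 1) `^ p by apply: powR_gt0.
have B : 0 < w `^ p by apply: powR_gt0.
have wn0 : w != 0 by rewrite gt_eqF.
(* The tangent inequality at [(w - 1) / w]. *)
have bern : (w - 1) `^ p <= w `^ p * (1 - p / w).
  rewrite -[X in X `^ p <= _](mulfVK wn0) mulrC.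
  rewrite (powRM _ (ltW w0)) ?ler_wpM2l ?(ltW B) ?divr_ge0 ?(ltW w0) ?(ltW w10)//.
  apply: le_trans (powR_le_tangent _ _) _;
    rewrite ?divr_ge0 ?(ltW w0) ?(ltW w10) ?(ltW p0)//.
  by rewrite le_eqVlt (_ : _ + _ = 1 - p / w) ?eqxx//; field.
rewrite !powRN powRD ?wn0 ?implybT// powRr1 ?(ltW w0)//.
have -> : p * (w * w `^ p)^-1 = (p / w) * (w `^ p)^-1 by rewrite invfM mulrA.
rewrite lerBrDr -[X in _ + X]mul1r -mulrDl ler_pdivrMr// [leRHS]mulrC ler_pdivlMr//.
have q0 : 0 <= p / w by rewrite divr_ge0 ?ltW.
apply: le_trans (ler_wpM2l _ bern) _; first lra.
by rewrite mulrCA -[leRHS]mulr1 ler_wpM2l ?(ltW B)//; nra.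
Qed.

Lemma riemann_sum_bounded a : 1 < a ->
  exists2 Z, 0 < Z & forall m, \sum_(l < m) (l.+1%:R : R) `^ (- a) <= Z.
Proof.
(* The telescoping bound needs an exponent in [(0, 1]]. *)
move=> a1; pose b := Num.min 1 (a - 1).
have b01 : 0 < b <= 1 by rewrite /b lt_min ge_min lexx ltr01/= andbT; lra.
have /andP[b0 b1] := b01.
have ba : 1 + b <= a by rewrite /b; case: (leP 1 (a - 1)); lra.
exists (1 + b^-1); first by rewrite addr_gt0 ?invr_gt0.
suff H m : \sum_(l < m.+1) (l.+1%:R : R) `^ (- (1 + b)) <=
    1 + b^-1 * (1 - m.+1%:R `^ (- b)).
  move=> m; apply: (@le_trans _ _ (\sum_(l < m.+1) (l.+1%:R : R) `^ (- (1 + b)))).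
    rewrite big_ord_recr/= ler_wpDr ?powR_ge0//; apply: ler_sum => l _.
    by rewrite ler_powR ?ler1n// lerN2.
  apply: le_trans (H m) _; rewrite lerD2l -[leRHS]mulr1.
  by rewrite ler_wpM2l ?invr_ge0 ?(ltW b0)// gerBl powR_ge0.
elim: m => [|m IH].
  by rewrite big_ord1 !powR1 subrr mulr0 addr0.
rewrite big_ord_recr/=; apply: le_trans (lerD IH (lexx _)) _.
rewrite -addrA lerD2l -lerBrDl -mulrBr ler_pdivlMl//.
have := @powR_shift_sub b m.+2%:R b01; rewrite ltr1n => /(_ isT).
by rewrite -(natrB _ (isT : (0 < m.+2)%N)) subSS subn0; lra.
Qed.

(** Stands in for [1 - k <= expR (- k)]: a product of many small deficits is
    small as soon as their sum is large. *)
Lemma prod_compl_le m (k : 'I_m -> R) : (forall l, 0 <= k l <= 1) ->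
  (\prod_(l < m) (1 - k l)) * (1 + \sum_(l < m) k l) <= 1.
Proof.
elim: m k => [|m IH] k k01; first by rewrite !big_ord0 addr0 mulr1.
rewrite !big_ord_recr/=.
have := IH (fun l => k (widen_ord (leqnSn m) l)) (fun l => k01 _).
set P := \prod_(_ < _) _; set S := \sum_(_ < _) _ => PS.
have P0 : 0 <= P by apply: prodr_ge0 => l _; have := k01 (widen_ord (leqnSn m) l); lra.
have S0 : 0 <= S by apply: sumr_ge0 => l _; have := k01 (widen_ord (leqnSn m) l); lra.
have /andP[x0 x1] := k01 ord_max.
move: (k ord_max) x0 x1 => x x0 x1.
apply: le_trans PS; rewrite -mulrA ler_wpM2l//; nra.
Qed.

End ScalarInequalities.

(** * Random combinations of real numbers *)

Section Sampling.
Context {R : realType}.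

Local Notation choices m M := {ffun 'I_m -> 'I_M.+1}.

(** The coefficients [U] are bad when the combination nearly cancels, compared
    with the size of [a l0]. *)
Definition dither_bad m N (a : 'I_m -> R) l0 (U : choices m N) :=
  2 * `|\sum_(l < m) (U l)%:R * a l| < `|a l0|.

(** When only the coefficient of [a l0] moves, the values of the combination
    are spaced by at least [`|a l0|], hence at most one of them has absolute
    value below [`|a l0| / 2]. Rotating this coefficient therefore meets at
    most one bad choice out of [N.+1]. *)
Lemma dither_bad_rare m N (a : 'I_m -> R) (l0 : 'I_m) :
  ((\sum_(U : choices m N) dither_bad a l0 U) * N.+1 <=
   #|choices m N|)%N.
Proof.
pose shift (k : 'I_N.+1) (U : choices m N) :=
  [ffun l => if l == l0 then U l + k else U l].
have shiftK k : cancel (shift k) (shift (- k)).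
  by move=> U; apply/ffunP => l; rewrite !ffunE; case: eqP; rewrite ?addrK.
have shiftB k : bijective (shift k).
  exists (shift (- k)) => //.
  by move=> U; have := shiftK (- k) U; rewrite opprK.
have -> : ((\sum_(U : choices m N) dither_bad a l0 U) * N.+1 =
    \sum_(U : choices m N) \sum_(k < N.+1) dither_bad a l0 (shift k U))%N.
  rewrite [RHS]exchange_big /= [RHS](eq_bigr (fun=> \sum_(U : choices m N)
      dither_bad a l0 U)%N) => [|k _].
    by rewrite sum_nat_const card_ord mulnC.
  by rewrite [RHS](reindex (shift k))//; apply: onW_bij.
rewrite -sum1_card; apply: leq_sum => U _.
rewrite -big_mkcond/= sum1_card; apply/card_le1_eqP => k k' bk bk'.
have {}bk : dither_bad a l0 (shift k U) by [].
have {}bk' : dither_bad a l0 (shift k' U) by [].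
have E j : \sum_(l < m) (shift j U l)%:R * a l =
    (U l0 + j)%R%:R * a l0 + \sum_(l < m | l != l0) (U l)%:R * a l.
  rewrite (bigD1 l0)//= ffunE eqxx; congr (_ + _).
  by apply: eq_bigr => l /negPf ll0; rewrite ffunE ll0.
move: bk bk'; rewrite /dither_bad !E; set y := \sum_(_ < _ | _) _ => bk bk'.
suff /addrI : U l0 + k = U l0 + k' by [].
apply: val_inj; move: (U l0 + k) (U l0 + k') bk bk' => i j bi bj.
apply/eqP; rewrite -(eqr_nat R) -subr_eq0 -normr_le0 leNgt; apply/negP => ij.
have : `|(i%:R - j%:R) * a l0| < `|a l0|.
  rewrite (_ : _ * _ = (i%:R * a l0 + y) - (j%:R * a l0 + y)); last by ring.
  by apply: le_lt_trans (ler_normB _ _) _; lra.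
rewrite normrM gtr_pMl; last by apply: le_lt_trans bi; rewrite mulr_ge0.
suff : 1 <= `|i%:R - j%:R : R| by lra.
by rewrite norm_intr_ge1 ?rpredB ?natr_int// -normr_gt0.
Qed.

Lemma dither_mean m N (a : 'I_m -> R) l0 v : 0 <= v <= `|a l0| ->
  (1 - N.+1%:R^-1) * v * #|choices m N|%:R <=
  \sum_(U : choices m N)
    Num.min v (2 * `|\sum_(l < m) (U l)%:R * a l|).
Proof.
move=> /andP[v0 va]; set T := #|_|.
have N0 : 0 < N.+1%:R :> R by rewrite ltr0n.
apply: (@le_trans _ _ (\sum_(U : choices m N)
    (v - v * (dither_bad a l0 U)%:R))).
  rewrite sumrB sumr_const -/T -mulr_sumr -natr_sum -[v *+ _]mulr_natr.
  have -> : (1 - N.+1%:R^-1) * v * T%:R = v * T%:R - v * (N.+1%:R^-1 * T%:R) by ring.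
  rewrite lerD2l lerN2 ler_wpM2l// ler_pdivlMl// mulrC -natrM ler_nat.
  exact: dither_bad_rare.
apply: ler_sum => U _; rewrite /dither_bad; case: ltP => h /=.
  by rewrite mulr1 subrr le_min v0 mulr_ge0.
by rewrite mulr0 subr0 le_min lexx (le_trans va).
Qed.

(** The sum counts the positive integers up to [m] that are at most [B]. *)
Lemma count_levels m (B : R) :
  Num.min m%:R (B - 1) <= \sum_(l < m) ((l.+1%:R <= B)%R%:R : R).
Proof.
elim: m => [|m IH]; first by rewrite big_ord0 ge_min lexx.
rewrite big_ord_recr/= -[m.+1%:R]natr1; case: (leP (m%:R + 1) B) => h /=.
  move: IH; rewrite min_l => [IH|]; rewrite ?ge_min; [apply/orP; left|]; lra.
by move: IH; rewrite ge_min => /orP[?|?]; rewrite ge_min; apply/orP; right; lra.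
Qed.

(** At level [l], counted from 0, a value is large when its [p]-th power is at
    least [(l + 1) / (L + 1)] times that of [v]. *)
Definition above_level p L v (l : nat) (x : R) : bool :=
  l.+1%:R * v `^ p <= L.+1%:R * `|x| `^ p.

(** Indices picked independently at the [m] levels all fail to be large with
    probability [\prod_l (1 - k l)], where [k l] is the proportion of indices
    that are large at level [l]. Counting levels index by index, the [k l] add
    up to at least [L], as the [p]-th powers average to at least that of
    [v]. *)
Lemma pick_rare p m M L (b : 'I_M.+1 -> R) v : m = (M.+1 * L)%N -> 0 < v ->
  v `^ p <= M.+1%:R^-1 * \sum_i `|b i| `^ p ->
  \sum_(w : choices m M)
     [forall l : 'I_m, ~~ above_level p L v l (b (w l))]%:R
  <= L.+1%:R^-1 * #|choices m M|%:R :> R.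
Proof.
move=> mE v0 vb.
pose good (l : 'I_m) i := above_level p L v l (b i).
have vp0 : 0 < v `^ p by rewrite powR_gt0.
pose B i := L.+1%:R * `|b i| `^ p / v `^ p.
have M0 : 0 < M.+1%:R :> R by rewrite ltr0n.
pose k l : R := M.+1%:R^-1 * \sum_i (good l i)%:R.
have k01 l : 0 <= k l <= 1.
  rewrite /k mulr_ge0 ?invr_ge0 ?sumr_ge0//=.
  rewrite ler_pdivrMl// mulr1 -natr_sum ler_nat -[leqRHS]card_ord -sum1_card.
  by apply: leq_sum => i _; case: (good l i).
have kL : L%:R <= \sum_l k l.
  rewrite -mulr_sumr ler_pdivlMl// -natrM -mE exchange_big/=.
  pose S i := \sum_(l < m) (good l i)%:R : R.
  have S0 i : 0 <= S i by rewrite sumr_ge0.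
  have SB i : Num.min m%:R (B i - 1) <= S i.
    apply: le_trans (count_levels m (B i)) _; apply: ler_sum => l _.
    by rewrite /good /above_level /B ler_pdivlMr.
  (* An index that is large at every level suffices on its own; otherwise the
     minimum in [count_levels] is never [m]. *)
  have [/existsP[i mi]|/existsPn mS] := boolP [exists i, m%:R <= S i].
    by rewrite (bigD1 i)//= ler_wpDr// sumr_ge0// => j _; apply: S0.
  apply: (@le_trans _ _ (\sum_i (B i - 1))).
    rewrite sumrB sumr_const card_ord /B -mulr_suml -mulr_sumr.
    move: vb; rewrite ler_pdivlMl// => vb.
    rewrite lerBrDr mE -natrD -mulnSr ler_pdivlMr// natrM.
    by rewrite [_%:R * _%:R]mulrC -mulrA ler_wpM2l.
  apply: ler_sum => i _; move: (SB i); rewrite ge_min.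
  by rewrite (negPf (mS i)).
have -> : \sum_(w : choices m M)
     [forall l : 'I_m, ~~ above_level p L v l (b (w l))]%:R
   = \prod_(l < m) \sum_(i < M.+1) (~~ good l i)%:R :> R.
  rewrite bigA_distr_bigA/=; apply: eq_bigr => w _.
  have [/forallP h|/forallPn[l h]] :=
    boolP [forall l : 'I_m, ~~ above_level p L v l (b (w l))].
    by rewrite big1// => l _; rewrite /good (h l).
  by rewrite (bigD1 l)//= (negPf h) mul0r.
have -> : \prod_(l < m) \sum_(i < M.+1) (~~ good l i)%:R =
    \prod_(l < m) (M.+1%:R * (1 - k l)) :> R.
  apply: eq_bigr => l _; rewrite mulrBr mulr1 /k mulVKf ?gt_eqF//.
  rewrite -[X in X%:R - _]card_ord -sum1_card natr_sum -sumrB.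
  by apply: eq_bigr => i _; case: (good l i); rewrite ?subrr ?subr0.
rewrite big_split/= prodr_const card_ord card_ffun !card_ord natrX.
rewrite [leRHS]mulrC ler_wpM2l ?exprn_ge0// -[leRHS]mul1r ler_pdivlMr ?ltr0n//.
apply: le_trans (prod_compl_le k01); rewrite ler_wpM2l ?prodr_ge0//.
  by move=> l _; have := k01 l; lra.
by rewrite -natr1; lra.
Qed.

(** The factor that brings a value that is large at level [l] above [v]; its
    [s]-th powers are summable over [l] as soon as [p < s]. *)
Definition level_coef p L (l : nat) : R := (L.+1%:R / l.+1%:R) `^ p^-1.

Lemma above_levelW p L v l x : 0 < p -> 0 <= v -> above_level p L v l x ->
  v <= `|level_coef p L l * x|.
Proof.
move=> p0 v0; rewrite /above_level -ler_pdivlMl ?ltr0n// mulrA [_^-1 * _]mulrC => h.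
have c0 : 0 <= L.+1%:R / l.+1%:R :> R by rewrite divr_ge0.
have pK (y : R) : 0 <= y -> (y `^ p) `^ p^-1 = y.
  by move=> y0; rewrite -powRrM divff ?gt_eqF// powRr1.
rewrite normrM ger0_norm ?powR_ge0// -[leLHS]pK// -[X in _ * X]pK// -powRM ?powR_ge0//.
by rewrite ge0_ler_powR ?nnegrE ?mulr_ge0 ?powR_ge0// invr_ge0 ltW.
Qed.

(** Choosing both the indices [wU.1] and the integer coefficients [wU.2] at
    random, the combination exceeds [v] with probability at least
    [(1 - L.+1%:R^-1) ^+ 2]: some picked value is large by [pick_rare], and it
    is not cancelled by [dither_mean]. The coefficients [level_coef] do not
    depend on the values [b], so that one family of combinations serves all
    points of a lattice at once. *)
Lemma sample_mean p m M L (b : 'I_M.+1 -> R) v :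
  0 < p -> m = (M.+1 * L)%N -> 0 <= v ->
  v `^ p <= M.+1%:R^-1 * \sum_i `|b i| `^ p ->
  (1 - L.+1%:R^-1) ^+ 2 * v *
    #|{: choices m M * choices m L}|%:R <=
  \sum_(wU : choices m M * choices m L)
    Num.min v (2 * `|\sum_(l < m) (wU.2 l)%:R * (level_coef p L l * b (wU.1 l))|).
Proof.
move=> p0 mE; rewrite le_eqVlt => /predU1P[<- _|v0 vb].
  rewrite mulr0 mul0r; apply: sumr_ge0 => wU _.
  by rewrite le_min lexx/= mulr_ge0.
pose miss (w : choices m M) : bool := [forall l : 'I_m, ~~ above_level p L v l (b (w l))].
have L0 : 0 <= 1 - L.+1%:R^-1 :> R by rewrite subr_ge0 invf_le1 ?ler1n ?ltr0n.
rewrite -(pair_bigA _ (fun (w : choices m M) (u : choices m L) => Num.min v (2 *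
  `|\sum_(l < m) (u l)%:R * (level_coef p L l * b (w l))|)))/=.
apply: (@le_trans _ _ (\sum_(w : choices m M) (1 - (miss w)%:R) *
    ((1 - L.+1%:R^-1) * v * #|choices m L|%:R))).
  rewrite -mulr_suml sumrB sumr_const card_prod natrM.
  rewrite expr2 -!mulrA.
  have := pick_rare mE v0 vb; rewrite -/miss => miss_le.
  have W0 : (1 - L.+1%:R^-1) * #|choices m M|%:R <=
      #|choices m M|%:R - \sum_w (miss w)%:R :> R.
    by rewrite mulrBl mul1r lerD2l lerN2.
  have V0 : 0 <= (1 - L.+1%:R^-1) * (v * #|choices m L|%:R) by rewrite !mulr_ge0 ?(ltW v0).
  by apply: le_trans (ler_wpM2r V0 W0); rewrite le_eqVlt; apply/orP; left; apply/eqP; ring.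
apply: ler_sum => w _; rewrite /miss.
case: (boolP [forall l : 'I_m, ~~ above_level p L v l (b (w l))]) => /= [_|].
  by rewrite subrr mul0r; apply: sumr_ge0 => u _; rewrite le_min (ltW v0) mulr_ge0.
move=> /forallPn[l /negPn hl]; rewrite subr0 mul1r.
apply: (@dither_mean _ _ (fun l => level_coef p L l * b (w l)) l).
by rewrite (ltW v0) above_levelW// ltW.
Qed.

End Sampling.

(** * Vector lattices and their points *)

Section VectorLatticeTheory.
Context {R : realType} {V : vectorLatticeType R}.
Implicit Types (x y z w : V) (a k : R).

Lemma vlerD x y z w : x <= y -> z <= w -> x + z <= y + w.
Proof.
move=> xy zw; apply: le_trans (vlat_lerD _ _ z xy) _.
by rewrite ![y + _]addrC vlat_lerD.
Qed.

Lemma vaddr_ge0 x y : 0 <= x -> 0 <= y -> 0 <= x + y.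
Proof. by move=> x0 y0; have := vlerD x0 y0; rewrite addr0. Qed.

Lemma vler_wpDr x y z : 0 <= z -> x <= y -> x <= y + z.
Proof. by move=> z0 xy; have := vlerD xy z0; rewrite addr0. Qed.

Lemma vler_wpDl x y z : 0 <= z -> x <= y -> x <= z + y.
Proof. by rewrite addrC; exact: vler_wpDr. Qed.

Lemma vler_subl x y z : (x - y <= z) = (x <= z + y).
Proof.
apply/idP/idP => h; last by have := vlat_lerD _ _ (- y) h; rewrite addrK.
by have := vlat_lerD _ _ y h; rewrite subrK.
Qed.

Lemma vler_subr x y z : (x <= z - y) = (x + y <= z).
Proof. by rewrite -vler_subl opprK. Qed.

Lemma vsubr_ge0 x y : (0 <= y - x) = (x <= y).
Proof. by rewrite vler_subr add0r. Qed.

Lemma vlerN x y : (- y <= - x) = (x <= y).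
Proof. by rewrite -[LHS]vsubr_ge0 opprK addrC vsubr_ge0. Qed.

Lemma vler_oppl x y : (- x <= y) = (- y <= x).
Proof. by rewrite -[LHS]vlerN opprK. Qed.

Lemma vler_oppr x y : (x <= - y) = (y <= - x).
Proof. by rewrite -[LHS]vlerN opprK. Qed.

Lemma vlerZ a x y : 0 <= a -> x <= y -> a *: x <= a *: y.
Proof.
move=> a0 xy; rewrite -[_ <= _]vsubr_ge0 -scalerBr.
by rewrite vlat_scaler_ge0// vsubr_ge0.
Qed.

Lemma vlerZl a k x : 0 <= x -> a <= k -> a *: x <= k *: x.
Proof.
move=> x0 ak; rewrite -[_ <= _]vsubr_ge0 -scalerBl.
by rewrite vlat_scaler_ge0// subr_ge0.
Qed.

Lemma vjoin_ubl x y : x <= vjoin x y.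
Proof. by have := vjoin_le x y (vjoin x y); rewrite lexx => /esym/andP[]. Qed.

Lemma vjoin_ubr x y : y <= vjoin x y.
Proof. by have := vjoin_le x y (vjoin x y); rewrite lexx => /esym/andP[]. Qed.

Lemma vjoin_lub x y z : x <= z -> y <= z -> vjoin x y <= z.
Proof. by rewrite vjoin_le => -> ->. Qed.

Lemma vmeet_lbl x y : vmeet x y <= x.
Proof. by have := vmeet_ge x y (vmeet x y); rewrite lexx => /esym/andP[]. Qed.

Lemma vmeet_lbr x y : vmeet x y <= y.
Proof. by have := vmeet_ge x y (vmeet x y); rewrite lexx => /esym/andP[]. Qed.

Lemma vmeetE x y : vmeet x y = - vjoin (- x) (- y).
Proof.
apply: le_anti; rewrite vmeet_ge; apply/andP; split; last first.
  by rewrite vler_oppl vjoin_ubl vler_oppl vjoin_ubr.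
by rewrite vler_oppr; apply: vjoin_lub; rewrite vlerN ?vmeet_lbl ?vmeet_lbr.
Qed.

Lemma vjoin_idr x y : x <= y -> vjoin x y = y.
Proof. by move=> xy; apply: le_anti; rewrite vjoin_ubr vjoin_lub. Qed.

Lemma vjoinC x y : vjoin x y = vjoin y x.
Proof. by apply: le_anti; rewrite !vjoin_le !vjoin_ubl !vjoin_ubr. Qed.

Lemma vjoinZ a x y : 0 <= a -> vjoin (a *: x) (a *: y) = a *: vjoin x y.
Proof.
rewrite le_eqVlt => /predU1P[<-|a0].
  by rewrite !scale0r vjoin_idr.
apply: le_anti; rewrite vjoin_lub ?vlerZ ?(ltW a0) ?vjoin_ubl ?vjoin_ubr//=.
have an0 : a != 0 by rewrite gt_eqF.
have ai0 : 0 <= a^-1 by rewrite invr_ge0 ltW.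
suff h : vjoin x y <= a^-1 *: vjoin (a *: x) (a *: y).
  by have := vlerZ (ltW a0) h; rewrite scalerKV.
apply: vjoin_lub.
  by have := vlerZ ai0 (vjoin_ubl (a *: x) (a *: y)); rewrite scalerK.
by have := vlerZ ai0 (vjoin_ubr (a *: x) (a *: y)); rewrite scalerK.
Qed.

Lemma labs_ge x : x <= labs x. Proof. exact: vjoin_ubl. Qed.

Lemma labs_geN x : - x <= labs x. Proof. exact: vjoin_ubr. Qed.

Lemma labs_le x y : (labs x <= y) = (x <= y) && (- x <= y).
Proof. exact: vjoin_le. Qed.

Lemma labs_ge0 x : 0 <= labs x.
Proof.
have := vlerD (labs_ge x) (labs_geN x); rewrite subrr -mulr2n -scaler_nat => h.
have h2 : 0 <= 2^-1 :> R by rewrite invr_ge0.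
by have := vlerZ h2 h; rewrite scaler0 scalerA mulVf ?scale1r.
Qed.

Lemma labsN x : labs (- x) = labs x.
Proof. by rewrite /labs opprK vjoinC. Qed.

Lemma labs_le2 x y : - y <= x -> x <= y -> labs x <= y.
Proof. by move=> h1 h2; rewrite labs_le h2 vler_oppl. Qed.

Lemma ger0_labs x : 0 <= x -> labs x = x.
Proof.
move=> x0; rewrite /labs vjoinC vjoin_idr// (le_trans _ x0)//.
by rewrite vler_oppl oppr0.
Qed.

Lemma labs_id x : labs (labs x) = labs x.
Proof. by rewrite ger0_labs ?labs_ge0. Qed.

Lemma labs0 : labs 0 = 0 :> V.
Proof. exact: ger0_labs. Qed.

Lemma labsD x y : labs (x + y) <= labs x + labs y.
Proof.
by rewrite labs_le opprD !vlerD ?labs_ge ?labs_geN.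
Qed.

Lemma labsZ a x : labs (a *: x) = `|a| *: labs x.
Proof.
have [a0|a0] := leP 0 a; first by rewrite (ger0_norm a0) /labs -scalerN vjoinZ.
have Na0 : 0 <= - a by rewrite oppr_ge0 ltW.
by rewrite (ltr0_norm a0) /labs -vjoinZ// scalerN !scaleNr !opprK vjoinC.
Qed.

Lemma vjoinD x y z : vjoin (x + z) (y + z) = vjoin x y + z.
Proof.
apply: le_anti; rewrite vjoin_lub ?vlerD ?vjoin_ubl ?vjoin_ubr//=.
by rewrite -vler_subr vjoin_lub// vler_subr ?vjoin_ubl ?vjoin_ubr.
Qed.

(** The positive and the negative part of an element are disjoint. *)
Lemma disjoint_parts_le0 y z k : 0 <= k ->
  z <= k *: vjoin y 0 -> z <= k *: vjoin (- y) 0 -> z <= 0.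
Proof.
rewrite le_eqVlt => /predU1P[<-|k0]; first by rewrite scale0r.
have kn0 : k != 0 by rewrite gt_eqF.
have k1 : 0 <= k^-1 by rewrite invr_ge0 ltW.
move=> /(vlerZ k1); rewrite scalerK// => h1 /(vlerZ k1); rewrite scalerK// => h2.
have {}h1 : 0 <= vjoin y 0 - k^-1 *: z by rewrite vsubr_ge0.
have {}h2 : y <= vjoin y 0 - k^-1 *: z.
  move: h2; rewrite -{1}[- y]add0r -(subrr y) vjoinD vjoinC !vler_subr => h2.
  by rewrite addrC.
have := vjoin_lub h2 h1; rewrite vler_subr addrC -vler_subr subrr => /(vlerZ (ltW k0)).
by rewrite scalerKV// scaler0.
Qed.

Lemma vjoin_dist x y x' y' :
  labs (vjoin x y - vjoin x' y') <= labs (x - x') + labs (y - y').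
Proof.
have half (u v u' v' : V) : vjoin u v - vjoin u' v' <= labs (u - u') + labs (v - v').
  rewrite vler_subl; apply: vjoin_lub.
    have := vlerD (vlerD (labs_ge (u - u')) (labs_ge0 (v - v'))) (vjoin_ubl u' v').
    by rewrite addr0 subrK.
  have := vlerD (vlerD (labs_ge0 (u - u')) (labs_ge (v - v'))) (vjoin_ubr u' v').
  by rewrite add0r subrK.
rewrite labs_le half/= opprB (le_trans (half _ _ _ _))//.
by rewrite -opprB labsN -[y' - y]opprB labsN.
Qed.

End VectorLatticeTheory.

Section Points.
Context {R : realType} {V : vectorLatticeType R}.
Implicit Types (x y z e : V) (a k : R).

(** Membership in the principal ideal generated by [e]. *)
Definition within e x : Prop := exists2 k, 0 <= k & labs x <= k *: e.

Lemma within_unit e : 0 <= e -> within e e.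
Proof. by move=> e0; exists 1; rewrite // scale1r ger0_labs. Qed.

Lemma within0 e : within e 0.
Proof. by exists 0; rewrite ?scale0r ?labs0. Qed.

Lemma withinD e x y : within e x -> within e y -> within e (x + y).
Proof.
move=> [k k0 hx] [l l0 hy]; exists (k + l); first by rewrite addr_ge0.
by rewrite scalerDl (le_trans (labsD _ _))// vlerD.
Qed.

Lemma withinZ e a x : within e x -> within e (a *: x).
Proof.
move=> [k k0 hx]; exists (`|a| * k); first by rewrite mulr_ge0.
by rewrite labsZ -scalerA vlerZ.
Qed.

Lemma withinN e x : within e x -> within e (- x).
Proof. by rewrite /within labsN. Qed.

Lemma withinU e x y : within e x -> within e y -> within e (vjoin x y).
Proof.
move=> [k k0 hx] [l l0 hy].
have ke : 0 <= k *: e := le_trans (labs_ge0 x) hx.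
have le_ : 0 <= l *: e := le_trans (labs_ge0 y) hy.
exists (k + l); first by rewrite addr_ge0.
rewrite scalerDl; apply: labs_le2; last first.
  apply: vjoin_lub; [apply: vler_wpDr|apply: vler_wpDl] => //.
    exact: le_trans (labs_ge _) hx.
  exact: le_trans (labs_ge _) hy.
apply: le_trans (vjoin_ubl _ _); rewrite vler_oppl.
by apply: vler_wpDr => //; apply: le_trans (labs_geN _) hx.
Qed.

Lemma within_le e e' x : 0 <= e -> e <= e' -> within e x -> within e' x.
Proof.
move=> e0 ee' [k k0 hx]; exists k => //.
by apply: le_trans hx _; rewrite vlerZ.
Qed.

Lemma within_solid e x y : labs y <= labs x -> within e x -> within e y.
Proof. by move=> yx [k k0 hx]; exists k => //; apply: le_trans yx hx. Qed.

(** A real lattice homomorphism on a principal ideal. It is a total function,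
    meaningful only on the elements [within] its unit: a lattice without
    strong unit may have no real lattice homomorphism on the whole space. *)
Record point := Point {
  unit_of : V;
  evaluation :> V -> R;
  evaluation_linear : forall a x y, within unit_of x -> within unit_of y ->
    evaluation (a *: x + y) = a * evaluation x + evaluation y;
  evaluation_join : forall x y, within unit_of x -> within unit_of y ->
    evaluation (vjoin x y) = Num.max (evaluation x) (evaluation y) }.
Implicit Type c : point.

Section Evaluation.
Variable c : point.
Local Notation within := (within (unit_of c)).

Lemma ev0 : c 0 = 0.
Proof.
have := evaluation_linear 1 (within0 (unit_of c)) (within0 (unit_of c)).
by rewrite scale1r addr0 mul1r => /eqP; rewrite -subr_eq subrr eq_sym => /eqP.
Qed.

Lemma evZ a x : within x -> c (a *: x) = a * c x.
Proof.
move=> wx; rewrite -[a *: x]addr0 evaluation_linear ?ev0 ?addr0//.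
exact: within0.
Qed.

Lemma evD x y : within x -> within y -> c (x + y) = c x + c y.
Proof. by move=> wx wy; rewrite -{1}[x]scale1r evaluation_linear ?mul1r. Qed.

Lemma evN x : within x -> c (- x) = - c x.
Proof. by move=> wx; rewrite -scaleN1r evZ ?mulN1r. Qed.

Lemma evB x y : within x -> within y -> c (x - y) = c x - c y.
Proof. by move=> wx wy; rewrite evD ?evN//; apply: withinN. Qed.

Lemma ev_meet x y : within x -> within y -> c (vmeet x y) = Num.min (c x) (c y).
Proof.
move=> wx wy; rewrite vmeetE evN ?evaluation_join ?evN//; last 1 first.
- by apply: withinU; apply: withinN.
- by rewrite oppr_max !opprK.
- exact: withinN.
- exact: withinN.
Qed.

Lemma ev_labs x : within x -> c (labs x) = `|c x|.
Proof.
by move=> wx; rewrite /labs evaluation_join ?evN ?maxrN//; apply: withinN.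
Qed.

Lemma ev_le x y : within x -> within y -> x <= y -> c x <= c y.
Proof.
move=> wx wy xy; rewrite -(vjoin_idr xy) evaluation_join//.
by rewrite le_max lexx.
Qed.

Lemma within_sum (I : Type) (r : seq I) (f : I -> V) :
  (forall i, within (f i)) -> within (\sum_(i <- r) f i).
Proof.
move=> wf; elim/big_rec: _ => [|i x _ wx]; first exact: within0.
exact: withinD.
Qed.

Lemma ev_sum (I : Type) (r : seq I) (f : I -> V) :
  (forall i, within (f i)) -> c (\sum_(i <- r) f i) = \sum_(i <- r) c (f i).
Proof.
move=> wf; elim: r => [|i r IH]; first by rewrite !big_nil ev0.
by rewrite !big_cons evD ?IH//; apply: within_sum.
Qed.

End Evaluation.

(** A statement holds at nearly all points when it holds at those whose
    domain, a principal ideal, is large enough: every element of the lattice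
    can be evaluated at nearly all points. *)
Definition points : set_system point :=
  [set A | exists2 e, 0 <= e & forall c, 0 <= unit_of c -> e <= unit_of c -> A c].

End Points.

Notation "'\forall_points' c , P" := {near points, forall c : point, P}
  (at level 200, c name, P at level 200).

Section NearPoints.
Context {R : realType} {V : vectorLatticeType R}.
Implicit Types x : V.

#[global] Instance points_filter : Filter (@points R V).
Proof.
split.
- by exists 0.
- move=> A B [e e0 Ae] [f f0 Bf]; exists (e + f).
    exact: vaddr_ge0.
  move=> c c0 efc; split; [apply: Ae => //|apply: Bf => //].
    by apply: le_trans efc; rewrite vler_wpDr.
  by apply: le_trans efc; rewrite vler_wpDl.
- by move=> A B AB [e e0 Ae]; exists e => // c c0 ec; apply/AB/Ae.
Qed.

Lemma near_within x : \forall_points c, within (unit_of c) x.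
Proof.
exists (labs x) => [|c c0 xc]; first exact: labs_ge0.
apply: within_le xc _; first exact: labs_ge0.
by exists 1; rewrite ?scale1r.
Qed.

End NearPoints.

(** * Maximal ideals and the Yosida theorem *)

Section MaximalIdeals.
Context {R : realType} {V : vectorLatticeType R}.
Implicit Types (x y z e m : V) (a k : R) (M J : set V).

Definition order_ideal M : Prop :=
  [/\ M 0, (forall x y, M x -> M y -> M (x + y)),
      (forall a x, M x -> M (a *: x)) &
      (forall x y, M x -> labs y <= labs x -> M y)].

(** The ideal generated by [M] and [y], when [M] is an ideal. *)
Definition adjoin M y : set V :=
  [set x | exists m k, [/\ M m, 0 <= k & labs x <= labs m + k *: labs y]].

Lemma order_ideal0 : order_ideal [set 0 : V].
Proof.
split=> //= [x y -> ->|a x ->|x y -> ].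
- by rewrite addr0.
- by rewrite scaler0.
rewrite labs0 => h; apply: le_anti; rewrite (le_trans (labs_ge y) h)/=.
by have := le_trans (labs_geN y) h; rewrite vler_oppl oppr0.
Qed.

Lemma order_ideal_adjoin M y : order_ideal M -> order_ideal (adjoin M y).
Proof.
move=> [M0 MD MZ MS]; split.
- by exists 0, 0; split=> //; rewrite scale0r !labs0 addr0.
- move=> x z [m [k [Mm k0 xm]]] [n [l [Mn l0 zn]]].
  exists (labs m + labs n), (k + l); split.
  + by apply: MD; [apply: MS Mm _|apply: MS Mn _]; rewrite labs_id.
  + exact: addr_ge0.
  rewrite (@ger0_labs _ _ (labs m + labs n)); last first.
    by rewrite vaddr_ge0 ?labs_ge0.
  by rewrite scalerDl addrACA (le_trans (labsD _ _))// vlerD.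
- move=> a x [m [k [Mm k0 xm]]]; exists (a *: m), (`|a| * k); split.
  + exact: MZ.
  + by rewrite mulr_ge0.
  by rewrite !labsZ -scalerA -scalerDr vlerZ.
- move=> x z [m [k [Mm k0 xm]]] zx; exists m, k; split=> //.
  exact: le_trans zx xm.
Qed.

Lemma sub_adjoin M y : M `<=` adjoin M y.
Proof. by move=> x Mx; exists x, 0; rewrite scale0r addr0. Qed.

Lemma mem_adjoin M y : M 0 -> adjoin M y y.
Proof. by move=> M0; exists 0, 1; rewrite labs0 add0r scale1r. Qed.

Lemma maximal_ideal_exists J e : order_ideal J -> ~ J e ->
  exists M, [/\ order_ideal M, J `<=` M, ~ M e &
    forall x, ~ M x -> adjoin M x e].
Proof.
move=> idJ Je; pose good M := [/\ order_ideal M, J `<=` M & ~ M e].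
(* The union of the empty chain is empty, hence the first disjunct. *)
pose P : set (set V) := [set M | M = set0 \/ good M].
have [] := @Zorn_bigcup V P.
  move=> F FP Ftot.
  have [[A FA [x Ax]]|F0] := pselect (exists2 A, F A & A !=set0); last first.
    left; rewrite -subset0 => x [A FA Ax]; apply: F0; exists A => //.
    by exists x.
  have goodF B y : F B -> B y -> good B.
    by move=> /FP[->//|].
  have goodA := goodF A x FA Ax.
  right; split; last by move=> [B FB Be]; have [_ _] := goodF B e FB Be; apply.
    split.
    - by exists A => //; case: goodA => -[].
    - move=> y z [B FB By] [C FC Cz].
      have [BC|CB] := Ftot B C FB FC.
        exists C => //; have [[_ CD _ _] _ _] := goodF C z FC Cz.
        by apply: CD => //; apply: BC.
      exists B => //; have [[_ BD _ _] _ _] := goodF B y FB By.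
      by apply: BD => //; apply: CB.
    - move=> a y [B FB By]; exists B => //.
      by have [[_ _ BZ _] _ _] := goodF B y FB By; apply: BZ.
    - move=> y z [B FB By] zy; exists B => //.
      by have [[_ _ _ BS] _ _] := goodF B y FB By; apply: BS zy.
  by move=> y Jy; exists A => //; case: goodA => _ + _; apply.
move=> M [[M0|[idM JM Me]] Mmax].
  have J0 : J 0 by case: idJ.
  case: (Mmax J); last by right; split.
  by rewrite M0; split; [exact: sub0set|move=> /(_ 0 J0)].
exists M; split=> // x Mx; apply: contrapT => nadj.
have M0 : M 0 by case: idM.
case: (Mmax (adjoin M x)).
  split; first exact: sub_adjoin.
  by move=> /(_ x (mem_adjoin _ M0)) /Mx.
right; split => //; first exact: order_ideal_adjoin.
by move=> y /JM; apply: sub_adjoin.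
Qed.

Section MaximalPoint.
Variables (M : set V) (e : V).
Hypotheses (e0 : 0 <= e) (idM : order_ideal M) (Me : ~ M e)
  (Mmax : forall x, ~ M x -> adjoin M x e).

Let MD : forall x y, M x -> M y -> M (x + y). Proof. by case: idM. Qed.
Let MZ : forall a x, M x -> M (a *: x). Proof. by case: idM. Qed.
Let MS : forall x y, M x -> labs y <= labs x -> M y. Proof. by case: idM. Qed.

Let MSpos x y : M x -> 0 <= y -> y <= x -> M y.
Proof.
move=> Mx y0 yx; apply: MS Mx _; rewrite ger0_labs// (le_trans yx)//.
exact: labs_ge.
Qed.

Let Mlabs x : M x -> M (labs x).
Proof. by move=> /MS; apply; rewrite labs_id. Qed.

Let M_scaled_unit a : M (a *: e) -> a = 0.
Proof.
move=> Mae; apply/eqP; apply: contra_notT Me => a0.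
by rewrite -(scalerK a0 e); apply: MZ.
Qed.

(** If neither the positive nor the negative part of [y] were in [M], adjoining
    either of them would produce [e]; as both parts are disjoint, [e] would be
    in [M] already. *)
Lemma maximal_ideal_prime y : ~ M (vjoin y 0) -> M (vjoin (- y) 0).
Proof.
move=> My; apply: contrapT => My'.
have [m [k [Mm k0]]] := Mmax My; have [n [l [Mn l0]]] := Mmax My'.
have pos z : labs (vjoin z 0) = vjoin z 0 by rewrite ger0_labs// vjoin_ubr.
rewrite !pos ger0_labs// => en em; apply: Me.
apply: (@MSpos (labs m + labs n)) => //; first by apply: MD; apply: Mlabs.
have kl : 0 <= k + l by rewrite addr_ge0.
have yp z : 0 <= vjoin z 0 by rewrite vjoin_ubr.
suff : e - (labs m + labs n) <= 0 by rewrite vler_subl add0r.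
apply: (@disjoint_parts_le0 _ _ y _ (k + l)) => //.
  rewrite vler_subl (le_trans em)// addrC scalerDl vlerD//.
    by rewrite vler_wpDr ?vlat_scaler_ge0 ?yp.
  by rewrite vler_wpDr ?labs_ge0.
rewrite vler_subl (le_trans en)// addrC scalerDl vlerD//.
  by rewrite vler_wpDl ?vlat_scaler_ge0 ?yp.
by rewrite vler_wpDl ?labs_ge0.
Qed.

(** The real number [t] such that [x] and [t *: e] are equal modulo [M]. *)
Definition spectral_value x : R := sup [set t | M (vjoin (t *: e - x) 0)].

(** The difference is smaller than every multiple of [e] modulo [M]. Were it
    outside [M], maximality would bound [e] by a multiple of it modulo [M],
    hence by [K * eta *: e] with [K * eta < 1], and [e] would be in [M]. *)
Lemma spectral_value_mem x : within e x -> M (x - spectral_value x *: e).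
Proof.
move=> [k k0 xk]; pose S := [set t | M (vjoin (t *: e - x) 0)].
have M0 : M 0 by case: idM.
have Sk : S (- k).
  rewrite /S/= vjoin_idr// vler_subl add0r scaleNr vler_oppl.
  exact: le_trans (labs_geN _) xk.
have Sub t : S t -> t <= k.
  move=> St; rewrite leNgt; apply/negP => kt.
  have tk0 : 0 <= (t - k) *: e by rewrite vlat_scaler_ge0 ?subr_ge0 ?(ltW kt).
  suff /M_scaled_unit/eqP : M ((t - k) *: e) by rewrite subr_eq0 gt_eqF.
  apply: MSpos St _ _ => //; apply: le_trans (vjoin_ubl _ _).
  rewrite scalerBl vler_subl -addrA vler_wpDr//.
  by rewrite addrC vsubr_ge0; apply: le_trans (labs_ge _) xk.
have supS : has_sup S by split; [exists (- k)|exists k].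
rewrite /spectral_value -/S; set s := sup S; set y := x - s *: e.
apply: contrapT => /Mmax[m [K [Mm K0]]]; rewrite ger0_labs// => eK.
(* Any positive [eta] with [K * eta < 1] would do. *)
pose eta := (2 * (K + 1))^-1 : R.
have K1 : 0 < K + 1 by rewrite ltr_wpDl.
have eta0 : 0 < eta by rewrite invr_gt0 mulr_gt0.
have Keta : K * eta < 1.
  by rewrite /eta ltr_pdivrMr ?mulr_gt0//; lra.
have [t St tlt] := sup_adherent eta0 supS.
have nS : ~ S (s + eta).
  by move=> /(ub_le_sup supS.2); rewrite -/s gerDl leNgt eta0.
have := maximal_ideal_prime nS; rewrite opprB.
set p := vjoin (x - _) 0 => Mp; set q := vjoin (t *: e - x) 0 in St.
have p0 : 0 <= p by rewrite vjoin_ubr.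
have q0 : 0 <= q by rewrite vjoin_ubr.
have yle : labs y <= p + q + eta *: e.
  have etae : 0 <= eta *: e by rewrite vlat_scaler_ge0 ?(ltW eta0).
  rewrite labs_le; apply/andP; split.
    have : x - (s + eta) *: e <= p by exact: vjoin_ubl.
    rewrite scalerDl opprD addrA -/y vler_subl => h.
    by rewrite (le_trans h)// vlerD// vler_wpDr.
  have h : t *: e - x <= q by exact: vjoin_ubl.
  have h2 : s *: e <= (t + eta) *: e.
    by rewrite vlerZl//; rewrite ltrBlDr in tlt; exact: ltW.
  rewrite /y opprB vler_subl (le_trans h2)// scalerDl addrAC vlerD//.
  move: h; rewrite vler_subl => h; rewrite (le_trans h)// vlerD//.
  by rewrite vler_wpDl.
have w : (1 - K * eta) *: e <= labs m + K *: (p + q).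
  rewrite scalerBl scale1r vler_subl -addrA -scalerA -scalerDr.
  by rewrite (le_trans eK)// vlerD// vlerZ.
have c0 : 0 <= 1 - K * eta by rewrite subr_ge0 ltW.
suff /M_scaled_unit/eqP : M ((1 - K * eta) *: e) by rewrite subr_eq0 gt_eqF.
apply: (MSpos _ _ w); last by rewrite vlat_scaler_ge0.
by apply: MD; [exact: Mlabs|apply: MZ; apply: MD].
Qed.

Lemma spectral_value_unique x a : M (x - a *: e) -> within e x ->
  spectral_value x = a.
Proof.
move=> Mxa /spectral_value_mem Mx.
have : M ((a - spectral_value x) *: e).
  have -> : (a - spectral_value x) *: e =
      (x - spectral_value x *: e) + -1 *: (x - a *: e).
    by rewrite scaleN1r opprB [RHS]addrC addrA subrK scalerBl.
  by apply: MD => //; apply: MZ.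
by move=> /M_scaled_unit/eqP; rewrite subr_eq0 => /eqP.
Qed.

Lemma maximal_ideal_point : exists c : point,
  [/\ unit_of c = e, c e = 1 & forall x, within e x -> M x -> c x = 0].
Proof.
have lin a x y : within e x -> within e y ->
    spectral_value (a *: x + y) = a * spectral_value x + spectral_value y.
  move=> wx wy; apply: spectral_value_unique; last by apply/withinD/wy/withinZ.
  rewrite scalerDl -scalerA opprD addrACA -scalerBr.
  by apply: MD; [apply: MZ|]; apply: spectral_value_mem.
have join x y : within e x -> within e y -> spectral_value (vjoin x y) =
    Num.max (spectral_value x) (spectral_value y).
  move=> wx wy; apply: spectral_value_unique; last exact: withinU.
  set a := spectral_value x; set b := spectral_value y.
  have -> : Num.max a b *: e = vjoin (a *: e) (b *: e).
    case: (leP a b) => [ab|/ltW ba]; first by rewrite vjoin_idr// vlerZl.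
    by rewrite vjoinC vjoin_idr// vlerZl.
  apply: (@MS (labs (x - a *: e) + labs (y - b *: e))).
    by apply: MD; apply/Mlabs/spectral_value_mem.
  by rewrite (@ger0_labs _ _ (labs _ + labs _)) ?vjoin_dist// vaddr_ge0 ?labs_ge0.
exists (Point lin join); split=> //= [|x wx Mx].
  apply: spectral_value_unique; last exact: within_unit.
  by rewrite scale1r subrr; case: idM.
by apply: spectral_value_unique => //; rewrite scale0r subr0.
Qed.

End MaximalPoint.

Hypothesis archimedean : forall x y, (forall n, n%:R *: x <= y) -> x <= 0.

(** Points detect the order (Yosida). If [z = x - y] is not negative, then by
    the archimedean property neither is [u = n%:R *: z - e] for some [n]. The
    ideal generated by the negative part of [u] then avoids [e], and the point
    of a maximal ideal containing it sends [u] to a nonnegative number and [e]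
    to 1, hence [z] to a positive number. *)
Lemma points_le x y : (\forall_points c, c x <= c y) -> x <= y.
Proof.
move=> [f f0 xy]; rewrite -vsubr_ge0 -[y - x]opprB vler_oppr oppr0.
set z := x - y; pose e := f + (labs x + labs y).
have xy0 : 0 <= labs x + labs y by rewrite vaddr_ge0 ?labs_ge0.
have e0 : 0 <= e by rewrite vaddr_ge0.
have wx : within e x.
  exists 1 => //; rewrite scale1r /e addrCA vler_wpDr//.
  by rewrite vaddr_ge0 ?labs_ge0.
have wy : within e y.
  exists 1 => //; rewrite scale1r /e addrA addrC vler_wpDr//.
  by rewrite vaddr_ge0 ?labs_ge0.
apply: contrapT => z0.
have [n nz] : exists n : nat, ~ n%:R *: z <= e.
  apply: contrapT => h; apply/z0/(@archimedean _ e) => n.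
  by apply: contrapT => h'; apply: h; exists n.
have wz : within e z by apply/withinD/withinN.
pose u := n%:R *: z - e.
have wu : within e u by apply: withinD; [exact: withinZ|exact/withinN/within_unit].
have u0 : ~ u <= 0 by rewrite /u vler_subl add0r.
have wu' : within e (vjoin (- u) 0) by apply: withinU; [exact: withinN|exact: within0].
have idJ := order_ideal_adjoin (vjoin (- u) 0) order_ideal0.
have nJ : ~ adjoin [set 0] (vjoin (- u) 0) e.
  move=> [m [k [/= -> k0]]]; rewrite labs0 add0r !ger0_labs ?vjoin_ubr// => ek.
  have [K K0 uK] := wu; apply: u0.
  apply: le_trans (vjoin_ubl u 0) _.
  apply: (@disjoint_parts_le0 _ _ u _ (K * k + 1)).
  - by rewrite addr_ge0 ?mulr_ge0.
  - rewrite scalerDl scale1r vler_wpDl//.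
    by rewrite vlat_scaler_ge0 ?mulr_ge0 ?vjoin_ubr.
  rewrite scalerDl scale1r vler_wpDr ?vjoin_ubr//.
  rewrite -scalerA; apply: vjoin_lub; last by rewrite !vlat_scaler_ge0// vjoin_ubr.
  by rewrite (le_trans (labs_ge u))// (le_trans uK)// vlerZ.
have [M [idM JM Me Mmax]] := maximal_ideal_exists idJ nJ.
have [c [ce c1 cM]] := maximal_ideal_point e0 idM Me Mmax.
have cu : 0 <= c u.
  have := cM _ wu' (JM _ (mem_adjoin _ erefl)).
  rewrite evaluation_join ?evN ?ev0 ?ce//; [|exact: withinN|exact: within0].
  by case: (leP (- c u) 0) => h h'; lra.
have fe : f <= e by rewrite /e vler_wpDr.
have : c x <= c y by apply: xy; rewrite ce.
move: cu; rewrite /u evB ?evZ ?evB ?ce//; [|exact: withinZ|exact: within_unit].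
rewrite c1 => h1 h2.
have := mulr_ge0_le0 (ler0n R n) (_ : c x - c y <= 0); rewrite subr_le0 => /(_ h2).
by lra.
Qed.

End MaximalIdeals.

(** * Averaging in L-convex lattices *)

Section QuasiNorm.
Context {R : realType}.

Lemma qnorm0 (E : quasiBanachType R) : qnorm (0 : E) = 0.
Proof. by rewrite -(scale0r (0 : E)) qnormZ normr0 mul0r. Qed.

Lemma qnorm_labs (F : quasiBanachLatticeType R) (x : F) :
  qnorm (labs x) = qnorm x.
Proof. by apply/eqP; rewrite eq_le !qnorm_mono// labs_id. Qed.

Lemma qnorm_le (F : quasiBanachLatticeType R) (x y : F) :
  0 <= x -> x <= y -> qnorm x <= qnorm y.
Proof.
move=> x0 xy; apply: qnorm_mono.
by rewrite !ger0_labs// (le_trans x0).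
Qed.

Lemma snorm_sum s (E : quasiBanachType R) (I : Type) (r : seq I) (f : I -> E) :
  0 < s -> is_snorm s E ->
  qnorm (\sum_(i <- r) f i) `^ s <= \sum_(i <- r) qnorm (f i) `^ s.
Proof.
move=> s0 Es; elim: r => [|i r IH].
  by rewrite !big_nil qnorm0 powR0 ?gt_eqF.
by rewrite !big_cons; apply: le_trans (Es _ _) _; rewrite lerD2l.
Qed.

(** The quasi-norm is monotone and definite. *)
Lemma qnorm_archimedean (F : quasiBanachLatticeType R) (x y : F) :
  (forall n : nat, n%:R *: x <= y) -> x <= 0.
Proof.
move=> nxy; set z := vjoin x 0.
have z0 : 0 <= z by exact: vjoin_ubr.
suff <- : z = 0 by exact: vjoin_ubl.
apply: qnorm_eq0; apply/eqP; rewrite eq_le qnorm_ge0 andbT leNgt; apply/negP => zgt0.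
have nz (n : nat) : n%:R * qnorm z <= qnorm y.
  rewrite -[n%:R]ger0_norm// -qnormZ -[leRHS]qnorm_labs; apply: qnorm_le.
    by rewrite vlat_scaler_ge0.
  rewrite /z -vjoinZ// scaler0 vjoin_lub ?labs_ge0//.
  exact: le_trans (nxy n) (labs_ge y).
have := nz (Num.bound (qnorm y / qnorm z)); rewrite -ler_pdivlMr// leNgt.
by rewrite archi_boundP// divr_ge0// qnorm_ge0.
Qed.

Lemma le_of_points (F : quasiBanachLatticeType R) (x y : F) :
  (\forall_points c, c x <= c y) -> x <= y.
Proof. exact/points_le/qnorm_archimedean. Qed.

(** L-convexity for averages over any finite type and without normalisation of
    [u]; the samples of [sample_mean] are indexed by pairs of functions. *)
Lemma L_convex_mean (F : quasiBanachLatticeType R) : L_convex F ->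
  exists2 eps : R, 0 < eps < 1 &
    forall (u : F) (I : finType) (y : I -> F) (K : R),
      0 <= u -> (0 < #|I|)%N -> (forall i, 0 <= y i /\ y i <= u) ->
      ((1 - eps) * #|I|%:R) *: u <= \sum_i y i ->
      (forall i, qnorm (y i) <= K) -> eps * qnorm u <= K.
Proof.
move=> [eps eps01 Leps]; exists eps => // u I y K u0 I0 yu uy yK.
have [/eqP qu0|qu0] := eqVneq (qnorm u) 0.
  have /card_gt0P[i _] := I0.
  by rewrite (eqP qu0) mulr0 (le_trans _ (yK i))// qnorm_ge0.
have qu : 0 < qnorm u by rewrite lt_neqAle eq_sym qu0 qnorm_ge0.
have t0 : 0 <= (qnorm u)^-1 by rewrite invr_ge0 ltW.
have cardI : #|I|.-1.+1 = #|I| by rewrite prednK.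
pose x (k : 'I_#|I|.-1.+1) := (qnorm u)^-1 *: y (enum_val (cast_ord cardI k)).
have sumx : \sum_k x k = (qnorm u)^-1 *: \sum_i y i.
  rewrite scaler_sumr [RHS](reindex (fun k => enum_val (cast_ord cardI k)))//=.
  exists (fun i => cast_ord (esym cardI) (enum_rank i)) => i _.
    by rewrite enum_valK cast_ordK.
  by rewrite cast_ordKV enum_rankK.
have := Leps ((qnorm u)^-1 *: u) _ x; rewrite sumx.
rewrite qnormZ ger0_norm// mulVf// => h.
rewrite -ler_pdivlMr//; apply: le_trans (h _ erefl _ _) _.
- by rewrite vlat_scaler_ge0.
- by move=> k; have [y0 yle] := yu (enum_val (cast_ord cardI k));
    rewrite vlat_scaler_ge0 ?vlerZ.
- rewrite cardI; have n0 : 0 <= #|I|%:R^-1 :> R by rewrite invr_ge0.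
  have swap a b (z : F) : a *: (b *: z) = b *: (a *: z) by rewrite !scalerA mulrC.
  rewrite swap [X in _ <= X]swap vlerZ//.
  have := vlerZ n0 uy; rewrite scalerA mulrCA mulVf ?mulr1//.
  by rewrite pnatr_eq0 -lt0n.
apply: bigmax_le => [|k _].
  have /card_gt0P[i _] := I0.
  by rewrite divr_ge0 ?(ltW qu)// (le_trans _ (yK i))// qnorm_ge0.
by rewrite /x qnormZ ger0_norm// mulrC ler_wpM2r.
Qed.

End QuasiNorm.

(** * Domination by averages of powers *)

Section PowerDomination.
Context {R : realType} {E : quasiBanachType R} {F : quasiBanachLatticeType R}.
Variables (delta : {linear E -> F}) (p s : R).
Hypotheses (p0 : 0 < p) (ps : p < s) (Es : is_snorm s E).
Hypotheses (delta_iso : isometric delta) (FL : L_convex F).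

Let s0 : 0 < s. Proof. exact: lt_trans ps. Qed.
Let pn0 : p != 0. Proof. by rewrite gt_eqF. Qed.
Let sn0 : s != 0. Proof. by rewrite gt_eqF. Qed.

(** The bound is uniform in the number [m] of terms because the [s]-th powers
    of the [level_coef] are summable; this is where [p < s] is used. *)
Lemma level_combination_bounded L : exists2 K : R, 0 < K &
  forall m M (y : 'I_M.+1 -> E) (w : {ffun 'I_m -> 'I_M.+1})
    (U : {ffun 'I_m -> 'I_L.+1}), (forall i, qnorm (y i) <= 1) ->
  qnorm (\sum_(l < m) (U l)%:R *: (level_coef p L l *: y (w l))) <= K.
Proof.
have [Z Z0 Zle] : exists2 Z : R, 0 < Z &
    forall m, \sum_(l < m) l.+1%:R `^ (- (s / p)) <= Z.
  by apply: riemann_sum_bounded; rewrite ltr_pdivlMr ?mul1r.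
have L0 : 0 < L.+1%:R :> R by rewrite ltr0n.
pose C := L.+1%:R `^ s * (L.+1%:R `^ (s / p)) * Z.
have C0 : 0 < C by rewrite !mulr_gt0 ?powR_gt0.
exists (C `^ s^-1); first exact: powR_gt0.
move=> m M y w U y1; set v := \sum_(_ < _) _.
have pK (x : R) : 0 <= x -> (x `^ s) `^ s^-1 = x.
  by move=> x0; rewrite -powRrM divff// powRr1.
rewrite -(pK (qnorm v)) ?qnorm_ge0//.
rewrite ge0_ler_powR ?nnegrE ?invr_ge0 ?(ltW s0) ?(ltW C0) ?powR_ge0//.
apply: le_trans (snorm_sum _ _ s0 Es) _.
apply: le_trans (ler_wpM2l _ (Zle m)); last by rewrite mulr_ge0 ?powR_ge0.
rewrite mulr_sumr; apply: ler_sum => l _.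
rewrite !qnormZ ger0_norm// ger0_norm ?powR_ge0// !powRM ?mulr_ge0 ?powR_ge0 ?qnorm_ge0//.
rewrite -[leRHS]mulrA ler_pM ?mulr_ge0 ?powR_ge0//.
  by rewrite ge0_ler_powR ?nnegrE ?(ltW s0)// ler_nat ltnW.
rewrite /level_coef -powRrM [p^-1 * s]mulrC powRM ?invr_ge0//.
rewrite -[l.+1%:R^-1]powR_inv1// -powRrM mulN1r -[leRHS]mulr1.
rewrite ler_pM ?mulr_ge0 ?powR_ge0//.
have e1 : 1 `^ s = 1 :> R by rewrite powR1.
by rewrite -[leRHS]e1 ge0_ler_powR ?nnegrE ?(ltW s0) ?qnorm_ge0.
Qed.

(** The samples [z] are obtained by cutting off random combinations of the
    [delta y] at [u]. They are bounded by [level_combination_bounded], and their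
    average is close to [u] by [sample_mean] at every point. *)
Lemma mean_domination_bounded : exists2 K : R, 0 < K &
  forall (u : F) (ys : seq E), 0 <= u -> (0 < size ys)%N ->
    (forall y, y \in ys -> qnorm y <= 1) ->
    (\forall_points c, c u `^ p <=
       (size ys)%:R^-1 * \sum_(y <- ys) `|c (delta y)| `^ p) ->
  qnorm u <= K.
Proof.
have [eps /andP[eps0 eps1] Leps] := L_convex_mean FL.
(* This [L] makes both failure probabilities in [sample_mean] at most
   [eps / 2]. *)
pose L := Num.truncn (2 / eps).
have Leps2 : 1 - eps <= (1 - L.+1%:R^-1) ^+ 2.
  have L1 : 0 < L.+1%:R :> R by rewrite ltr0n.
  have : 2 / eps < L.+1%:R by exact: truncnS_gt.
  rewrite ltr_pdivrMr// [_ * eps]mulrC -ltr_pdivrMr//.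
  by rewrite expr2; move: (L.+1%:R^-1) => t ht; have := sqr_ge0 t; rewrite expr2; lra.
have [K K0 HK] := level_combination_bounded L.
exists (2 * K / eps); first by rewrite divr_gt0 ?mulr_gt0.
move=> u ys u0 ys0 ys1 near_u.
pose M := (size ys).-1; have sizeM : size ys = M.+1 by rewrite prednK.
pose y (i : 'I_M.+1) := ys`_i.
have y1 i : qnorm (y i) <= 1 by rewrite ys1 ?mem_nth ?sizeM.
pose m := (M.+1 * L)%N.
pose comb (wU : {ffun 'I_m -> 'I_M.+1} * {ffun 'I_m -> 'I_L.+1}) :=
  \sum_(l < m) (wU.2 l)%:R *: (level_coef p L l *: y (wU.1 l)).
pose z wU := vmeet u (2 *: labs (delta (comb wU))).
rewrite ler_pdivlMr// mulrC; apply: (Leps u _ z) => //.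
- by apply/card_gt0P; exists ([ffun=> ord0], [ffun=> ord0]).
- move=> wU; rewrite /z vmeet_lbl vmeet_ge u0; split=> //.
  by rewrite vlat_scaler_ge0 ?labs_ge0.
- apply: le_of_points; near=> c.
  have wu : within (unit_of c) u by near: c; exact: near_within.
  have wy : forall i, within (unit_of c) (delta (y i)).
    by near: c; apply: filter_forall => i; exact: near_within.
  have deltaZ a x : delta (a *: x) = a *: delta x by rewrite linearZ_LR.
  have wcomb wU : within (unit_of c) (delta (comb wU)).
    rewrite raddf_sum; apply: within_sum => l /=.
    by rewrite !deltaZ; do 2 apply: withinZ; exact: wy.
  have wabs wU : within (unit_of c) (2 *: labs (delta (comb wU))).
    by apply: withinZ; apply: within_solid (wcomb wU); rewrite labs_id.
  have ccomb wU : c (delta (comb wU)) =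
      \sum_(l < m) (wU.2 l)%:R * (level_coef p L l * c (delta (y (wU.1 l)))).
    rewrite raddf_sum ev_sum => [|l /=]; last first.
      by rewrite !deltaZ; do 2 apply: withinZ; exact: wy.
    apply: eq_bigr => l _ /=; rewrite !deltaZ evZ; last by apply: withinZ; exact: wy.
    by rewrite evZ.
  rewrite evZ// ev_sum => [|wU]; last first.
    by rewrite /z vmeetE; apply: withinN; apply: withinU; apply: withinN.
  under eq_bigr => wU _.
    rewrite /z ev_meet// evZ ?ev_labs ?ccomb//; last first.
      by apply: within_solid (wcomb wU); rewrite labs_id.
    over.
  have cu : 0 <= c u.
    by rewrite -(ev0 c) ev_le//; exact: within0.
  have hb : c u `^ p <= M.+1%:R^-1 * \sum_i `|c (delta (y i))| `^ p.
    have : c u `^ p <= (size ys)%:R^-1 * \sum_(y <- ys) `|c (delta y)| `^ p.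
      by near: c.
    by rewrite (big_nth 0) big_mkord sizeM.
  apply: le_trans (sample_mean p0 (erefl m) cu hb).
  by rewrite mulrAC ler_wpM2r// ler_wpM2r.
move=> wU.
apply: le_trans (_ : qnorm (2 *: labs (delta (comb wU))) <= _).
  apply: qnorm_le; last exact: vmeet_lbr.
  by rewrite /z vmeet_ge u0 vlat_scaler_ge0 ?labs_ge0.
rewrite qnormZ ger0_norm// ler_wpM2l// qnorm_labs delta_iso.
exact: HK.
Unshelve. all: by end_near.
Qed.

End PowerDomination.

(** * Power balls *)

Section PowerBall.
Context {R : realType} {E : quasiBanachType R} {F : quasiBanachLatticeType R}.
Variables (delta : {linear E -> F}) (p : R).

(** The [p]-th power of the element usually written
    [(\sum_f |f|^p)^(1/p)], evaluated at a point. *)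
Definition power_sum (c : point) (fs : seq F) : R := \sum_(f <- fs) `|c f| `^ p.

(** Families [fs] rather than single elements: balls of families add up under
    concatenation ([power_ball_cat]), while an element representing the [p]-sum
    of a family would have to be constructed. The error term [h] makes the balls
    closed ([power_ball_closed]). *)
Definition power_ball (rho : R) (fs : seq F) : Prop :=
  forall eta : R, 0 < eta -> exists (h : F) (xs : seq E),
    [/\ qnorm h <= eta, \sum_(x <- xs) qnorm x `^ p <= rho &
      \forall_points c,
        power_sum c fs <= power_sum c (map delta xs) + `|c h| `^ p].

Hypothesis p01 : 0 < p < 1.
Let p0 : 0 < p. Proof. by case/andP: p01. Qed.
Let p1 : p < 1. Proof. by case/andP: p01. Qed.
Let pn0 : p != 0. Proof. by rewrite gt_eqF. Qed.

Lemma powRKp (x : R) : 0 <= x -> (x `^ p) `^ p^-1 = x.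
Proof. by move=> x0; rewrite -powRrM divff// powRr1. Qed.

Lemma powRpK (x : R) : 0 <= x -> (x `^ p^-1) `^ p = x.
Proof. by move=> x0; rewrite -powRrM mulVf// powRr1. Qed.

Lemma powRp_le (x y : R) : 0 <= y -> `|x| <= y -> `|x| `^ p <= y `^ p.
Proof. by move=> y0 xy; rewrite ge0_ler_powR ?nnegrE ?(ltW p0). Qed.

(** Lets two small error terms be replaced by a single one; the factor
    [2 `^ p^-1] absorbs the sum of two [p]-th powers. *)
Lemma merge_errors (eta : R) : 0 < eta -> exists2 d : R, 0 < d &
  forall h k : F, qnorm h <= d -> qnorm k <= d -> exists2 g : F, qnorm g <= eta &
    \forall_points c, `|c h| `^ p + `|c k| `^ p <= `|c g| `^ p.
Proof.
move=> eta0; have [D D1 HD] := @qnormD R F.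
have D0 : 0 < D by apply: lt_le_trans D1.
pose t := 2 `^ p^-1 : R; have t0 : 0 < t by rewrite powR_gt0.
exists (eta / (2 * D * t)); first by rewrite divr_gt0 ?mulr_gt0.
move=> h k hd kd; exists (t *: (labs h + labs k)).
  rewrite qnormZ gtr0_norm// (le_trans (ler_wpM2l (ltW t0) (HD _ _)))//.
  rewrite !qnorm_labs mulrA -ler_pdivlMl ?mulr_gt0//.
  apply: le_trans (lerD hd kd) _; rewrite le_eqVlt; apply/orP; left; apply/eqP.
  by field; rewrite !gt_eqF.
near=> c.
have wh : within (unit_of c) h by near: c; exact: near_within.
have wk : within (unit_of c) k by near: c; exact: near_within.
have wlh : within (unit_of c) (labs h) by apply: within_solid wh; rewrite labs_id.
have wlk : within (unit_of c) (labs k) by apply: within_solid wk; rewrite labs_id.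
rewrite evZ ?evD ?ev_labs//; last exact: withinD.
rewrite normrM (gtr0_norm t0) (@ger0_norm _ (_ + _)) ?addr_ge0//.
rewrite powRM ?addr_ge0 ?(ltW t0)//.
rewrite /t powRpK// mulr_natl mulr2n lerD// powRp_le ?addr_ge0// ?lerDl ?lerDr//.
Unshelve. all: by end_near.
Qed.

Lemma power_ball_le rho fs gs : power_ball rho fs ->
  (\forall_points c, power_sum c gs <= power_sum c fs) -> power_ball rho gs.
Proof.
move=> Bf gf eta /Bf[h [xs [hh hxs fxs]]]; exists h, xs; split=> //.
near=> c; apply: (@le_trans _ _ (power_sum c fs)); first by near: c.
by near: c.
Unshelve. all: by end_near.
Qed.

Lemma power_ball_incr rho rho' fs : rho <= rho' ->
  power_ball rho fs -> power_ball rho' fs.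
Proof.
move=> rr' Bf eta /Bf[h [xs [hh hxs fxs]]]; exists h, xs; split=> //.
exact: le_trans rr'.
Qed.

Lemma power_ball0 : power_ball 0 [::].
Proof.
move=> eta eta0; exists 0, [::]; split; [by rewrite qnorm0 ltW|by rewrite big_nil|].
by near=> c; rewrite /power_sum !big_nil add0r powR_ge0.
Unshelve. all: by end_near.
Qed.

Lemma power_ball_cat rho sigma fs gs : power_ball rho fs ->
  power_ball sigma gs -> power_ball (rho + sigma) (fs ++ gs).
Proof.
move=> Bf Bg eta eta0; have [d d0 Hd] := merge_errors eta0.
have [h [xs [hd hxs fxs]]] := Bf d d0; have [k [ys [kd kys gys]]] := Bg d d0.
have [g geta hkg] := Hd h k hd kd; exists g, (xs ++ ys); split=> //.
  by rewrite big_cat lerD.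
near=> c; rewrite /power_sum map_cat !big_cat/=.
have hf : power_sum c fs <= power_sum c (map delta xs) + `|c h| `^ p by near: c.
have hg : power_sum c gs <= power_sum c (map delta ys) + `|c k| `^ p by near: c.
have hk : `|c h| `^ p + `|c k| `^ p <= `|c g| `^ p by near: c.
apply: le_trans (lerD hf hg) _; rewrite addrACA lerD2l//.
Unshelve. all: by end_near.
Qed.

Lemma power_ball_sum (I : Type) (r : seq I) (w : I -> R) (f : I -> F) :
  (forall i, power_ball (w i) [:: f i]) ->
  power_ball (\sum_(i <- r) w i) (map f r).
Proof.
move=> Bf; elim: r => [|i r IH]; first by rewrite big_nil; exact: power_ball0.
by rewrite big_cons; exact: power_ball_cat (Bf i) IH.
Qed.

Lemma power_ballZ rho (a : R) f : power_ball rho [:: f] ->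
  power_ball (`|a| `^ p * rho) [:: a *: f].
Proof.
move=> Bf eta eta0; have a0 : 0 < `|a| + 1 by rewrite ltr_wpDl.
have [h [xs [hh hxs fxs]]] := Bf _ (divr_gt0 eta0 a0).
exists (a *: h), [seq a *: x | x <- xs]; split.
- rewrite qnormZ (le_trans (ler_wpM2l _ hh))// mulrCA ler_piMr ?(ltW eta0)//.
  by rewrite ler_pdivrMr// mul1r lerDl.
- rewrite big_map (eq_bigr (fun x => `|a| `^ p * qnorm x `^ p)) => [|x _].
    by rewrite -mulr_sumr ler_wpM2l ?powR_ge0.
  by rewrite qnormZ powRM ?qnorm_ge0.
near=> c.
have wf : within (unit_of c) f by near: c; exact: near_within.
have wh : within (unit_of c) h by near: c; exact: near_within.
have wx : forall i : 'I_(size xs), within (unit_of c) (delta xs`_i).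
  by near: c; apply: filter_forall => i; exact: near_within.
rewrite /power_sum big_seq1 -map_comp big_map.
have -> : \sum_(x <- xs) `|c ((delta \o (fun x => a *: x)) x)| `^ p =
    `|a| `^ p * power_sum c (map delta xs).
  rewrite /power_sum big_map mulr_sumr (big_nth 0) [RHS](big_nth 0) !big_mkord.
  apply: eq_bigr => i _.
  by rewrite /= linearZ_LR evZ ?normrM ?powRM//.
rewrite !evZ// !normrM !powRM// -mulrDr ler_wpM2l ?powR_ge0//.
have : power_sum c [:: f] <= power_sum c (map delta xs) + `|c h| `^ p by near: c.
by rewrite /power_sum big_seq1.
Unshelve. all: by end_near.
Qed.

Lemma power_ball_closed rho f :
  (forall eta : R, 0 < eta ->
     exists2 g : F, qnorm (f - g) <= eta & power_ball rho [:: g]) ->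
  power_ball rho [:: f].
Proof.
move=> Bf eta eta0; have [d d0 Hd] := merge_errors eta0.
have [g fgd Bg] := Bf d d0; have [h [xs [hd hxs gxs]]] := Bg d d0.
have [k keta hk] := Hd h (f - g) hd fgd; exists k, xs; split=> //.
near=> c.
have wf : within (unit_of c) f by near: c; exact: near_within.
have wg : within (unit_of c) g by near: c; exact: near_within.
have hg : power_sum c [:: g] <= power_sum c (map delta xs) + `|c h| `^ p by near: c.
have hkc : `|c h| `^ p + `|c (f - g)| `^ p <= `|c k| `^ p by near: c.
rewrite /power_sum big_seq1; move: hg; rewrite /power_sum big_seq1 => hg.
apply: (@le_trans _ _ (`|c g| `^ p + `|c (f - g)| `^ p)).
  apply: le_trans (powRD_le _ _ _) => //; last by rewrite p0 ltW.
  apply: powRp_le; first by rewrite addr_ge0.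
  by rewrite evB// -{1}(subrK (c g) (c f)) addrC ler_normD.
apply: le_trans (lerD hg (lexx _)) _; rewrite -addrA lerD2l//.
Unshelve. all: by end_near.
Qed.

Lemma power_ball_delta x : power_ball (qnorm x `^ p) [:: delta x].
Proof.
move=> eta eta0; exists 0, [:: x]; split; [by rewrite qnorm0 ltW|by rewrite big_seq1|].
near=> c; rewrite lerDl powR_ge0//.
Unshelve. all: by end_near.
Qed.

End PowerBall.

(** * Power balls are bounded *)

Section PowerBallBounded.
Context {R : realType} {E : quasiBanachType R} {F : quasiBanachLatticeType R}.
Variables (delta : {linear E -> F}) (p s : R).
Hypotheses (p01 : 0 < p < 1) (ps : p < s) (Es : is_snorm s E).
Hypotheses (delta_iso : isometric delta) (FL : L_convex F).
Let p0 : 0 < p. Proof. by case/andP: p01. Qed.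
Let pn0 : p != 0. Proof. by rewrite gt_eqF. Qed.

(** Rounding: replacing each [x] by about [N * qnorm x `^ p] copies of
    [x / qnorm x] gives a family [ys] of vectors of the unit ball that enter
    with equal weights, at the price of a factor 2. *)
Lemma equal_weights (xs : seq E) : \sum_(x <- xs) qnorm x `^ p <= 1 ->
  exists ys : seq E, [/\ (0 < size ys)%N, (forall y, y \in ys -> qnorm y <= 1) &
    forall c : point, (forall x, x \in xs -> within (unit_of c) (delta x)) ->
      (size ys)%:R * power_sum p c (map delta xs) <=
      2 * power_sum p c (map delta ys)].
Proof.
move=> xs1; pose N := (size xs).+1; have N0 : 0 < N%:R :> R by rewrite ltr0n.
pose mult (x : E) := (Num.truncn (N%:R * qnorm x `^ p)).+1.
pose unit x : E := (qnorm x)^-1 *: x.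
pose ys := flatten [seq nseq (mult x) (unit x) | x <- xs].
have sum1r (T : Type) (r : seq T) : \sum_(i <- r) 1 = (size r)%:R :> R.
  by elim: r => [|j r IH]; rewrite ?big_nil// big_cons IH [RHS]/= -natr1 addrC.
have sum_ys (f : E -> R) :
    \sum_(y <- ys) f y = \sum_(x <- xs) (mult x)%:R * f (unit x).
  rewrite big_flatten big_map; apply: eq_bigr => x _.
  by rewrite big_nseq iter_addr_0 mulr_natl.
have size_ys : (size ys).+1%:R <= 2 * N%:R :> R.
  have -> : (size ys).+1%:R = 1 + \sum_(x <- xs) (mult x)%:R :> R.
    rewrite -natr1 addrC; congr (_ + _).
    rewrite -(eq_bigr _ (fun x _ => mulr1 _)) -(sum_ys (fun=> 1)).
    by rewrite sum1r.
  have : \sum_(x <- xs) (mult x)%:R <= \sum_(x <- xs) (N%:R * qnorm x `^ p + 1) :> R.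
    apply: ler_sum => x _; rewrite /mult -natr1 lerD2r truncn_le.
    by rewrite mulr_ge0 ?powR_ge0.
  rewrite big_split/= -mulr_sumr sum1r.
  have := ler_wpM2l (ltW N0) xs1; rewrite mulr1 => h.
  by rewrite /N -natr1 in h *; lra.
(* The additional 0 makes the family nonempty. *)
exists (0 :: ys); split=> //= [y|c wx].
  rewrite inE => /predU1P[->|]; first by rewrite qnorm0.
  move=> /flattenP[_ /mapP[x _ ->]] /nseqP[-> _].
  rewrite /unit qnormZ ger0_norm ?invr_ge0 ?qnorm_ge0//.
  have [->|q0] := eqVneq (qnorm x) 0; first by rewrite mulr0.
  by rewrite mulVf.
have c0 : 0 <= power_sum p c (map delta xs) by rewrite sumr_ge0 // => f _; rewrite powR_ge0.
apply: le_trans (ler_wpM2r c0 size_ys) _; rewrite -mulrA ler_wpM2l//.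
rewrite /power_sum big_cons ler_wpDl ?powR_ge0// !big_map sum_ys mulr_sumr.
rewrite !big_seq; apply: ler_sum => x xin.
have [x0|x0] := eqVneq (qnorm x) 0.
  have -> : x = 0 by exact: qnorm_eq0.
  rewrite raddf0 ev0 normr0 powR0 ?gt_eqF// mulr0.
  by rewrite mulr_ge0 ?powR_ge0.
rewrite /unit linearZ_LR evZ; last exact: wx.
rewrite normrM ger0_norm ?invr_ge0 ?qnorm_ge0//.
rewrite powRM ?invr_ge0 ?qnorm_ge0// mulrA ler_wpM2r ?powR_ge0//.
rewrite -[(qnorm x)^-1]powR_inv1 ?qnorm_ge0// powRAC powR_inv1 ?powR_ge0//.
rewrite ler_pdivlMr; last by apply: powR_gt0; rewrite lt_neqAle eq_sym x0 qnorm_ge0.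
exact/ltW/truncnS_gt.
Qed.

(** Away from the error term [h], the element is dominated by an average of
    [p]-th powers of vectors of the unit ball. The part [u] of [labs f] above
    [2 `^ p^-1 *: labs h] vanishes at the points where the error is at least half of
    [`|c f| `^ p], and elsewhere the error can be absorbed. *)
Lemma power_ball_bounded : exists2 K : R, 0 < K &
  forall f, power_ball delta p 1 [:: f] -> qnorm f <= K.
Proof.
have [K K0 HK] := mean_domination_bounded p0 ps Es delta_iso FL.
have [D D1 HD] := @qnormD R F; have D0 : 0 < D by apply: lt_le_trans D1.
pose t := 2 `^ p^-1 : R; have t0 : 0 < t by rewrite powR_gt0.
pose r := 4 `^ p^-1 : R; have r0 : 0 < r by rewrite powR_gt0.
exists (D * (r * K + t)); first by rewrite mulr_gt0 ?addr_gt0 ?mulr_gt0.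
move=> f /(_ 1 ltr01)[h [xs [h1 xs1 near_f]]].
have [ys [ys0 ys1 xsys]] := equal_weights xs1.
pose u := vjoin (labs f - t *: labs h) 0.
have u0 : 0 <= u by exact: vjoin_ubr.
have fle : labs f <= u + t *: labs h by rewrite -vler_subl vjoin_ubl.
have th0 : 0 <= t *: labs h by rewrite vlat_scaler_ge0 ?labs_ge0 ?(ltW t0).
suff uK : qnorm (r^-1 *: u) <= K.
  rewrite -qnorm_labs; apply: le_trans (qnorm_le (labs_ge0 _) fle) _.
  apply: le_trans (HD _ _) _; rewrite ler_wpM2l ?(ltW D0)// lerD//.
    by move: uK; rewrite qnormZ gtr0_norm ?invr_gt0// ler_pdivrMl.
  by rewrite qnormZ gtr0_norm// qnorm_labs ler_piMr// ltW.
apply: (HK _ _ _ ys0 ys1); first by rewrite vlat_scaler_ge0 ?invr_ge0 ?(ltW r0).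
near=> c.
have wf : within (unit_of c) f by near: c; exact: near_within.
have wh : within (unit_of c) h by near: c; exact: near_within.
have wlf : within (unit_of c) (labs f) by apply: within_solid wf; rewrite labs_id.
have wlh : within (unit_of c) (labs h) by apply: within_solid wh; rewrite labs_id.
have wt : within (unit_of c) (labs f - t *: labs h).
  by apply/withinD => //; apply/withinN/withinZ.
have wu : within (unit_of c) u by apply: withinU => //; exact: within0.
have wx : forall x, x \in xs -> within (unit_of c) (delta x).
  have : forall i : 'I_(size xs), within (unit_of c) (delta xs`_i).
    by near: c; apply: filter_forall => i; exact: near_within.
  move=> wi x xin; have ix : (index x xs < size xs)%N by rewrite index_mem.
  by have := wi (Ordinal ix); rewrite /= nth_index.
have cu : c u = Num.max (`|c f| - t * `|c h|) 0.
  rewrite /u evaluation_join ?ev0//; last exact: within0.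
  by rewrite evB ?evZ ?ev_labs//; exact: withinZ.
have cu0 : 0 <= c u by rewrite cu le_max lexx orbT.
rewrite evZ// powRM ?invr_ge0 ?(ltW r0)//.
have -> : (r^-1) `^ p = 4^-1 :> R.
  by rewrite -[r^-1]powR_inv1 ?(ltW r0)// powRAC /r (powRpK p01)// powR_inv1.
have S0 : 0 <= power_sum p c (map delta xs) by rewrite sumr_ge0 // => g _; rewrite powR_ge0.
have hf : power_sum p c [:: f] <= power_sum p c (map delta xs) + `|c h| `^ p.
  by near: c.
have key : c u `^ p <= 2 * power_sum p c (map delta xs).
  move: hf; rewrite {1}/power_sum big_seq1 => hf.
  have [cfh|cfh] := leP `|c f| (t * `|c h|).
    by rewrite cu max_r ?subr_le0// powR0// mulr_ge0.
  have : t * `|c h| <= `|c f| by exact: ltW.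
  have h2 : 2 * `|c h| `^ p <= `|c f| `^ p.
    rewrite -[2](powRpK p01)// -/t -powRM ?(ltW t0)//.
    rewrite ge0_ler_powR ?nnegrE ?mulr_ge0 ?(ltW t0) ?(ltW p0)//.
    exact: ltW.
  have : c u `^ p <= `|c f| `^ p.
    rewrite ge0_ler_powR ?nnegrE ?(ltW p0)// cu ge_max normr_ge0 andbT.
    by rewrite lerBlDr lerDl mulr_ge0 ?(ltW t0).
  by lra.
have := xsys c wx; have := ler_wpM2l (ler0n R (size ys)) key.
rewrite [power_sum p c (map delta ys)]/power_sum big_map.
by rewrite ler_pdivlMl ?ltr0n; [lra|exact: ys0].
Unshelve. all: by end_near.
Qed.

End PowerBallBounded.

(** * The gauge of the power balls *)

Section Gauge.
Context {R : realType} {E : quasiBanachType R} {F : quasiBanachLatticeType R}.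
Variables (delta : {linear E -> F}) (p : R).

(** The assumptions under which the gauge of the power balls is a complete
    lattice [p]-norm. *)
Definition power_bounded : Prop := 0 < p < 1 /\
  exists2 K : R, 0 < K & forall f, power_ball delta p 1 [:: f] -> qnorm f <= K.

Definition gauge (f : F) : R := inf [set rho | power_ball delta p rho [:: f]].

(** The proof is a parameter of the predicate so that the closure properties,
    which rest on it, can be inferred from the predicate alone. *)
Definition finite_gauge of power_bounded : {pred F} :=
  fun f => `[< exists rho, power_ball delta p rho [:: f] >].

Variable pb : power_bounded.
Local Notation finite := (finite_gauge pb).
Local Notation ball r f := (power_ball delta p r [:: f]).
Let p01 : 0 < p < 1. Proof. by case: pb. Qed.
Let p0 : 0 < p. Proof. by case/andP: p01. Qed.
Let p1 : p < 1. Proof. by case/andP: p01. Qed.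

Lemma finiteP f : reflect (exists rho, ball rho f) (f \in finite).
Proof. exact: asboolP. Qed.

Lemma ball_ge0 rho f : ball rho f -> 0 <= rho.
Proof.
move=> /(_ 1 ltr01)[h [xs [_ + _]]]; apply: le_trans.
by apply: sumr_ge0 => x _; rewrite powR_ge0.
Qed.

Lemma ball_has_inf f : f \in finite -> has_inf [set rho | ball rho f].
Proof.
by move=> /finiteP[rho Bf]; split; [exists rho|exists 0 => r /ball_ge0].
Qed.

Lemma gauge_le rho f : ball rho f -> gauge f <= rho.
Proof. by move=> Bf; apply: ge_inf => //; exists 0 => r /ball_ge0. Qed.

Lemma gauge_lt rho f : f \in finite -> gauge f < rho -> ball rho f.
Proof.
move=> /ball_has_inf infB; rewrite -subr_gt0 => d0.
have [r Br] := inf_adherent d0 infB; rewrite -/(gauge f) addrC subrK => /ltW rr.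
exact: power_ball_incr Br.
Qed.

Lemma gauge_ge0 f : 0 <= gauge f.
Proof.
have [[x Bx]|h] := pselect (exists rho, ball rho f).
  by apply: lb_le_inf; [exists x|move=> r /ball_ge0].
rewrite /gauge (_ : [set _ | _] = set0) ?inf0// -subset0 => r Br.
by apply: h; exists r.
Qed.

Lemma finite_le f g : g \in finite ->
  (\forall_points c, `|c f| `^ p <= `|c g| `^ p) -> f \in finite /\ gauge f <= gauge g.
Proof.
move=> gfin fg.
have Bfg r : ball r g -> ball r f.
  move=> Bg; apply: power_ball_le Bg _; rewrite /power_sum.
  by near=> c; rewrite !big_seq1; near: c.
split; first by have [r /Bfg Bf] := finiteP _ gfin; apply/finiteP; exists r.
apply/ler_addgt0Pr => e e0; apply/gauge_le/Bfg/gauge_lt => //.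
by rewrite ltrDl.
Unshelve. all: by end_near.
Qed.

Lemma finite_solid f g : g \in finite -> labs f <= labs g ->
  f \in finite /\ gauge f <= gauge g.
Proof.
move=> gfin fg; apply: finite_le => //; near=> c.
have wf : within (unit_of c) f by near: c; exact: near_within.
have wg : within (unit_of c) g by near: c; exact: near_within.
rewrite ge0_ler_powR ?nnegrE ?(ltW p0)// -!ev_labs// ev_le//.
  by apply: within_solid wf; rewrite labs_id.
by apply: within_solid wg; rewrite labs_id.
Unshelve. all: by end_near.
Qed.

Lemma finiteD f g : f \in finite -> g \in finite ->
  f + g \in finite /\ gauge (f + g) <= gauge f + gauge g.
Proof.
have BD r t : ball r f -> ball t g -> ball (r + t) (f + g).
  move=> Bf Bg; apply: power_ball_le (power_ball_cat p01 Bf Bg) _; near=> c.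
  have wf : within (unit_of c) f by near: c; exact: near_within.
  have wg : within (unit_of c) g by near: c; exact: near_within.
  rewrite /power_sum big_seq1 big_cons big_seq1 evD//.
  apply: le_trans (powRD_le _ _ _) => //; last by rewrite p0 ltW.
  by apply: powRp_le; rewrite ?addr_ge0 ?ler_normD.
move=> ff gf; split.
  have [r Br] := finiteP _ ff; have [t Bt] := finiteP _ gf.
  by apply/finiteP; exists (r + t); apply: BD.
apply/ler_addgt0Pr => e e0; have e20 : 0 < e / 2 by rewrite divr_gt0.
rewrite [e]splitr addrACA; apply/gauge_le/BD; apply: gauge_lt => //.
  by rewrite ltrDl.
by rewrite ltrDl.
Unshelve. all: by end_near.
Qed.

Lemma finite0 : 0 \in finite.
Proof.
apply/finiteP; exists 0; apply: power_ball_le (power_ball0 _ _) _; near=> c.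
by rewrite /power_sum big_seq1 big_nil ev0 normr0 powR0// gt_eqF.
Unshelve. all: by end_near.
Qed.

Lemma finiteZ a f : f \in finite ->
  a *: f \in finite /\ gauge (a *: f) <= `|a| `^ p * gauge f.
Proof.
move=> ff; have [r Br] := finiteP _ ff; split.
  by apply/finiteP; exists (`|a| `^ p * r); apply: power_ballZ.
have a0 : 0 < `|a| `^ p + 1 by rewrite ltr_wpDl ?powR_ge0.
apply/ler_addgt0Pr => e e0.
have Be : ball (gauge f + e / (`|a| `^ p + 1)) f.
  by apply: gauge_lt => //; rewrite ltrDl divr_gt0.
apply: le_trans (gauge_le (power_ballZ a Be)) _.
rewrite mulrDr lerD2l mulrCA ler_piMr ?(ltW e0)//.
by rewrite ler_pdivrMr// mul1r lerDl.
Qed.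

(** By homogeneity, boundedness of the ball of size 1 compares the gauge with
    the ambient quasi-norm. *)
Lemma finite_qnorm_le : exists2 K : R, 0 < K &
  forall f, f \in finite -> qnorm f <= K * gauge f `^ p^-1.
Proof.
have [_ [K K0 HK]] := pb; exists K => // f ff.
have pi0 : 0 < p^-1 by rewrite invr_gt0.
have Bt t : 0 < t -> gauge f < t `^ p -> qnorm f <= K * t.
  move=> t0 /(gauge_lt ff) /(power_ballZ t^-1) Bf.
  rewrite mulrC -ler_pdivrMl//; have := HK (t^-1 *: f).
  rewrite qnormZ gtr0_norm ?invr_gt0//; apply; apply: power_ball_incr Bf.
  rewrite gtr0_norm ?invr_gt0// -powRM ?invr_ge0 ?(ltW t0)// mulVf ?powR1//.
  by rewrite gt_eqF.
apply/ler_addgt0Pr => e e0; rewrite -[e](mulVKf (_ : K != 0)) ?gt_eqF// -mulrDr.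
have d0 : 0 < K^-1 * e by rewrite mulr_gt0 ?invr_gt0.
apply: Bt; first by rewrite ltr_wpDl ?powR_ge0.
rewrite -{1}[gauge f](powRpK p01) ?gauge_ge0// gt0_ltr_powR ?nnegrE ?powR_ge0//.
  by rewrite addr_ge0 ?powR_ge0 ?(ltW d0).
by rewrite ltrDl.
Qed.

End Gauge.

(** * The lattice of elements of finite gauge *)

Section PowerSpace.
Context {R : realType} {E : quasiBanachType R} {F : quasiBanachLatticeType R}.
Variables (delta : {linear E -> F}) (p : R) (pb : power_bounded delta p).

Lemma finite_submod_closed : submod_closed (finite_gauge pb).
Proof.
split=> [|a f g ff gf]; first exact: finite0.
by have [/finiteD+ _] := finiteZ a ff; move=> /(_ _ gf)[].
Qed.

HB.instance Definition _ := GRing.isSubmodClosed.Build R F (finite_gauge pb)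
  finite_submod_closed.

Record power_space := PowerSpace {
  power_space_val : F;
  _ : power_space_val \in finite_gauge pb }.

HB.instance Definition _ := [isSub for power_space_val].
HB.instance Definition _ := [Choice of power_space by <:].
HB.instance Definition _ := [SubChoice_isSubLmodule of power_space by <:].
HB.instance Definition _ := [SubChoice_isSubPOrder of power_space by <: with ring_display].

Let p01 : 0 < p < 1. Proof. by case: pb. Qed.
Let p0 : 0 < p. Proof. by case/andP: p01. Qed.
Let pi0 : 0 < p^-1. Proof. by rewrite invr_gt0. Qed.

Lemma power_join_subproof (x y : power_space) :
  vjoin (\val x) (\val y) \in finite_gauge pb.
Proof.
have labs_fin (z : power_space) : labs (\val z) \in finite_gauge pb.
  by have [] := @finite_solid _ _ _ _ _ pb (labs (\val z)) _ (valP z) _; rewrite ?labs_id.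
have [xy_fin _] := finiteD (labs_fin x) (labs_fin y).
have [] := finite_solid xy_fin (_ : labs (vjoin (\val x) (\val y)) <= _) => //.
rewrite [labs (labs _ + _)]ger0_labs ?vaddr_ge0 ?labs_ge0//.
by have := vjoin_dist (\val x) (\val y) 0 0; rewrite (vjoin_idr (lexx 0)) !subr0.
Qed.

Lemma power_meet_subproof (x y : power_space) :
  vmeet (\val x) (\val y) \in finite_gauge pb.
Proof.
by rewrite vmeetE rpredN; exact: (power_join_subproof (- x) (- y)).
Qed.

Lemma power_lerD (x y z : power_space) : x <= y -> x + z <= y + z.
Proof. exact: vlat_lerD. Qed.

Lemma power_scaler_ge0 (a : R) (x : power_space) : 0 <= a -> 0 <= x -> 0 <= a *: x.
Proof. exact: vlat_scaler_ge0. Qed.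

Definition power_join x y := PowerSpace (power_join_subproof x y).
Definition power_meet x y := PowerSpace (power_meet_subproof x y).

Lemma power_join_le (x y z : power_space) :
  (power_join x y <= z) = (x <= z) && (y <= z).
Proof. exact: vjoin_le. Qed.

Lemma power_meet_ge (x y z : power_space) :
  (z <= power_meet x y) = (z <= x) && (z <= y).
Proof. exact: vmeet_ge. Qed.

HB.instance Definition _ := isVectorLattice.Build R power_space
  power_lerD power_scaler_ge0 power_join_le power_meet_ge.

(** The gauge is homogeneous of degree [p]. *)
Definition power_norm (x : power_space) : R := gauge delta p (\val x) `^ p^-1.

Lemma power_norm_ge0 x : 0 <= power_norm x.
Proof. exact: powR_ge0. Qed.

Lemma power_norm_le x y :
  gauge delta p (\val x) <= gauge delta p (\val y) -> power_norm x <= power_norm y.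
Proof. by move=> h; rewrite ge0_ler_powR ?nnegrE ?gauge_ge0 ?(ltW pi0). Qed.

Lemma power_normX x : power_norm x `^ p = gauge delta p (\val x).
Proof. by rewrite (powRpK p01) ?gauge_ge0. Qed.

Lemma power_norm_bound : exists2 K : R, 0 < K &
  forall x : power_space, qnorm (\val x) <= K * power_norm x.
Proof.
have [K K0 HK] := finite_qnorm_le pb; exists K => // x.
by apply: HK; exact: valP.
Qed.

Lemma power_norm_eq0 x : power_norm x = 0 -> x = 0.
Proof.
move=> x0; apply: val_inj; apply: qnorm_eq0.
have [K K0 HK] := power_norm_bound; have := HK x; rewrite x0 mulr0 => h.
by apply: le_anti; rewrite h qnorm_ge0.
Qed.

Lemma power_normZ (a : R) x : power_norm (a *: x) = `|a| * power_norm x.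
Proof.
have le_ (b : R) (y : power_space) : power_norm (b *: y) <= `|b| * power_norm y.
  have [_ h] := finiteZ b (valP y).
  rewrite -{1}[`|b|](powRKp p01)// -powRM ?powR_ge0 ?gauge_ge0//.
  by rewrite ge0_ler_powR ?nnegrE ?gauge_ge0 ?mulr_ge0 ?powR_ge0 ?gauge_ge0 ?(ltW pi0).
apply: le_anti; rewrite le_/=; have [->|a0] := eqVneq a 0.
  by rewrite normr0 mul0r power_norm_ge0.
have := le_ a^-1 (a *: x); rewrite scalerK// normfV.
by rewrite ler_pdivlMl// normr_gt0.
Qed.

Lemma power_normD : exists2 D : R, 1 <= D &
  forall x y : power_space, power_norm (x + y) <= D * (power_norm x + power_norm y).
Proof.
have two : 1 <= 2 `^ p^-1 :> R by rewrite -[leLHS](powRr0 2) ler_powR ?ler1n ?(ltW pi0).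
exists (2 `^ p^-1) => // x y; have [_ h] := finiteD (valP x) (valP y).
have maxM : gauge delta p (\val (x + y)) <=
    2 * Num.max (gauge delta p (\val x)) (gauge delta p (\val y)).
  have le2max (a b : R) : a + b <= 2 * Num.max a b by case: (leP a b) => ?; lra.
  exact: le_trans h (le2max _ _).
have M0 : 0 <= Num.max (gauge delta p (\val x)) (gauge delta p (\val y)).
  by rewrite le_max gauge_ge0.
have := ge0_ler_powR (ltW pi0) _ _ maxM.
rewrite !nnegrE gauge_ge0 mulr_ge0// => /(_ isT isT) /le_trans; apply; rewrite powRM// ler_wpM2l ?powR_ge0//.
case: (leP (gauge delta p (\val x)) (gauge delta p (\val y))) => _.
  exact: ler_wpDl (power_norm_ge0 x) (lexx (power_norm y)).
exact: ler_wpDr (power_norm_ge0 y) (lexx (power_norm x)).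
Qed.

(** Gauge balls are closed in the ambient lattice, so that a Cauchy sequence
    for the gauge converges to its ambient limit. *)
Lemma power_norm_complete (u : nat -> power_space) :
  (forall e : R, 0 < e -> exists N : nat, forall m n : nat,
     (N <= m)%N -> (N <= n)%N -> power_norm (u m - u n) < e) ->
  exists l : power_space, forall e : R, 0 < e -> exists N : nat, forall n : nat,
     (N <= n)%N -> power_norm (u n - l) < e.
Proof.
move=> cu; have [K K0 HK] := power_norm_bound.
have [|l Hl] := @qnorm_complete _ F (fun n => \val (u n)).
  move=> e e0; have [N HN] := cu _ (divr_gt0 e0 K0); exists N => m n Nm Nn.
  have := HN m n Nm Nn; rewrite ltr_pdivlMr// mulrC; apply: le_lt_trans.
  exact: (HK (u m - u n)).
have close (e : R) : 0 < e -> exists N : nat, forall n : nat, (N <= n)%N ->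
    power_ball delta p (e `^ p) [:: \val (u n) - l].
  move=> e0; have [N HN] := cu _ e0; exists N => n Nn.
  apply: (power_ball_closed p01) => eta eta0.
  have [M HM] := Hl _ eta0; exists (\val (u n - u (maxn N M))).
    have -> : \val (u n - u (maxn N M)) = \val (u n) - \val (u (maxn N M)) by [].
    by rewrite opprB addrC addrA subrK ltW// HM// leq_maxr.
  apply: (gauge_lt (valP _)); rewrite -power_normX.
  rewrite gt0_ltr_powR ?nnegrE ?power_norm_ge0 ?(ltW e0)//.
  by apply: HN => //; rewrite leq_maxl.
have lfin : l \in finite_gauge pb.
  have [N HN] := close 1 ltr01.
  have lN : \val (u N) - l \in finite_gauge pb.
    by apply/finiteP; exists (1 `^ p); apply: HN.
  have -> : l = \val (u N) - (\val (u N) - l) by rewrite opprB addrC subrK.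
  by apply: rpredB => //; exact: valP.
exists (PowerSpace lfin) => e e0.
have e20 : 0 < e / 2 by rewrite divr_gt0.
have [N HN] := close _ e20; exists N => n Nn.
apply: le_lt_trans (_ : e / 2 < e); last by lra.
rewrite -[e / 2](powRKp p01) ?(ltW e20)//.
rewrite ge0_ler_powR ?nnegrE ?gauge_ge0 ?powR_ge0 ?(ltW pi0)//.
exact/gauge_le/HN.
Qed.

HB.instance Definition _ := isQuasiBanach.Build R power_space
  power_norm_ge0 power_norm_eq0 power_normZ power_normD power_norm_complete.

Lemma power_norm_mono (x y : power_space) : labs x <= labs y -> qnorm x <= qnorm y.
Proof.
by move=> xy; apply: power_norm_le; have [] := finite_solid (valP y) xy.
Qed.

HB.instance Definition _ := isLatticeQuasiNorm.Build R power_space power_norm_mono.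

End PowerSpace.

(** * L-convexity of the gauge and the embedding *)

Section PowerSpaceLConvex.
Context {R : realType} {E : quasiBanachType R} {F : quasiBanachLatticeType R}.
Variables (delta : {linear E -> F}) (p : R) (pb : power_bounded delta p).

Let p01 : 0 < p < 1. Proof. by case: pb. Qed.
Let p0 : 0 < p. Proof. by case/andP: p01. Qed.
Let p1 : p < 1. Proof. by case/andP: p01. Qed.
Let pi0 : 0 < p^-1. Proof. by rewrite invr_gt0. Qed.

Lemma qnorm_power (x : power_space pb) :
  qnorm x `^ p = gauge delta p (\val x).
Proof. exact: power_normX. Qed.

(** Since each [x k] lies between 0 and [u], chords of the concave power give
    [(x k)^p >= u^(p - 1) (x k)] at every point. If the [x k] average to at
    least [(1 - eps) *: u], then [u^p] is at most the average of the [(x k)^p]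
    divided by [1 - eps], and the gauge of [u] at most the average of the gauges
    of the [x k] divided by [1 - eps]. *)
Lemma power_space_L_convex : L_convex (power_space pb).
Proof.
(* Then [eps `^ p / (1 - eps) < 1], as [eps `^ p] is 1/2 and [eps] is
   smaller. *)
pose eps := 2^-1 `^ p^-1 : R.
have eps0 : 0 < eps by rewrite powR_gt0 ?invr_gt0.
have epsX : eps `^ p = 2^-1 by rewrite (powRpK p01).
have eps_half : eps < 2^-1.
  have half0 : 0 <= 2^-1 :> R by rewrite invr_ge0.
  have half : 2^-1 < (2^-1 : R) `^ p.
    have h0 : 0 < 2^-1 :> R by rewrite invr_gt0.
    rewrite /powR gt_eqF// -[ltLHS]lnK// ltr_expR ltr_nMl//.
    by rewrite ln_lt0// h0 invf_lt1 ?ltr1n.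
  rewrite -[ltRHS](powRKp p01)// gt0_ltr_powR ?nnegrE ?powR_ge0//.
exists eps; first by rewrite eps0 (lt_trans eps_half)// invf_lt1 ?ltr1n.
move=> u n x u0 u1 xu uavg; rewrite leNgt; apply/negP => maxlt.
have xlt k : qnorm (x k) < eps.
  by apply: le_lt_trans maxlt; apply: (le_bigmax _ (fun k => qnorm (x k))).
pose a := (n.+1%:R * (1 - eps))^-1 : R.
have n0 : 0 < n.+1%:R :> R by rewrite ltr0n.
have e1 : 0 < 1 - eps by lra.
have a0 : 0 < a by rewrite invr_gt0 mulr_gt0.
pose t := a `^ p^-1.
have t0 : 0 < t by rewrite powR_gt0.
have tX : t `^ p = a by rewrite (powRpK p01) ?(ltW a0).
have Bx k : power_ball delta p (a * 2^-1) [:: t *: \val (x k)].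
  rewrite -tX -[t in t `^ p](gtr0_norm t0); apply/power_ballZ/(gauge_lt (valP _)).
  by rewrite -qnorm_power -epsX gt0_ltr_powR ?nnegrE ?qnorm_ge0 ?(ltW eps0).
have := power_ball_sum p01 (index_enum 'I_n.+1) Bx.
rewrite sumr_const card_ord -[_ *+ n.+1]mulr_natl => Bu.
have : gauge delta p (\val u) <= n.+1%:R * (a * 2^-1).
  apply: gauge_le; apply: power_ball_le Bu _; near=> c.
  have wu : within (unit_of c) (\val u) by near: c; exact: near_within.
  have wx : forall k, within (unit_of c) (\val (x k)).
    by near: c; apply: filter_forall => k; exact: near_within.
  have cx k : 0 <= c (\val (x k)) <= c (\val u).
    have [xk0 xku] := xu k; rewrite -(ev0 c) !ev_le//; exact: within0.
  have cu0 : 0 <= c (\val u) by have /andP[/le_trans h /h] := cx ord0.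
  have cavg : (1 - eps) * c (\val u) <= n.+1%:R^-1 * \sum_k c (\val (x k)).
    have wsum : within (unit_of c) (\val (\sum_k x k)).
      by rewrite raddf_sum; apply: within_sum.
    have : c (\val ((1 - eps) *: u)) <= c (\val (n.+1%:R^-1 *: \sum_k x k)).
      by apply: ev_le => //; rewrite !linearZ; apply: withinZ.
    by rewrite !linearZ !evZ// raddf_sum ev_sum.
  rewrite /power_sum big_seq1 big_map.
  have -> : \sum_k `|c (t *: \val (x k))| `^ p = a * \sum_k c (\val (x k)) `^ p.
    rewrite mulr_sumr; apply: eq_bigr => k _.
    have /andP[ck0 _] := cx k.
    by rewrite evZ// normrM gtr0_norm// ger0_norm// powRM ?(ltW t0)// tX.
  rewrite ger0_norm//; have [v0|v0] := eqVneq (c (\val u)) 0.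
    by rewrite v0 powR0 ?gt_eqF// mulr_ge0 ?(ltW a0)// sumr_ge0// => k _; rewrite powR_ge0.
  have vgt0 : 0 < c (\val u) by rewrite lt_neqAle eq_sym v0.
  rewrite -ler_pdivrMl// invrK.
  have chord : c (\val u) `^ p / c (\val u) * \sum_k c (\val (x k)) <=
      \sum_k c (\val (x k)) `^ p.
    rewrite mulr_sumr; apply: ler_sum => k _; rewrite mulrAC -mulrA.
    by apply: powR_chord => //; rewrite p0 ltW.
  apply: le_trans chord.
  move: cavg; rewrite ler_pdivlMl// => cavg.
  apply: le_trans (ler_wpM2l _ cavg); last by rewrite divr_ge0 ?powR_ge0.
  rewrite le_eqVlt; apply/orP; left; apply/eqP.
  by field; rewrite gt_eqF.
rewrite -qnorm_power u1 powR1 /a leNgt => /negP; apply.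
rewrite invfM mulrA mulrA mulfV ?gt_eqF// mul1r.
rewrite ltr_pdivrMr// mul1r -[ltLHS]mul1r ltr_pdivrMr//.
by rewrite -ltr_pdivrMl// mulr1 ltrBrDr [ltRHS]splitr mul1r ltrD2l.
Unshelve. all: by end_near.
Qed.

Lemma power_embedding_subproof x : delta x \in finite_gauge pb.
Proof. by apply/finiteP; exists (qnorm x `^ p); exact: power_ball_delta. Qed.

Definition power_embedding x : power_space pb :=
  PowerSpace (power_embedding_subproof x).

Lemma power_embedding_linear : linear power_embedding.
Proof. by move=> a x y; apply: val_inj; exact: linearP. Qed.

HB.instance Definition _ := GRing.isLinear.Build R E (power_space pb) _
  power_embedding power_embedding_linear.

Lemma power_embedding_continuous : qcontinuous power_embedding.
Proof.
move=> x e e0; exists e => // y; rewrite -raddfB; apply: le_lt_trans.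
rewrite -[leRHS](powRKp p01) ?qnorm_ge0//.
rewrite ge0_ler_powR ?nnegrE ?gauge_ge0 ?powR_ge0 ?(ltW pi0)//.
exact/gauge_le/power_ball_delta.
Qed.

Lemma power_space_val_lattice_hom :
  lattice_hom (\val : {linear power_space pb -> F}).
Proof.
have [K K0 HK] := power_norm_bound pb; split=> // x e e0.
exists (e / K); first by rewrite divr_gt0.
move=> y; rewrite ltr_pdivlMr// mulrC; apply: le_lt_trans.
exact: (HK (y - x)).
Qed.

End PowerSpaceLConvex.

(** * Krivine calculus and conclusion *)

Section PowerSums.
Context {R : realType}.
Variable p : R.
Hypothesis p01 : 0 < p < 1.
Let p0 : 0 < p. Proof. by case/andP: p01. Qed.
Let p1 : p < 1. Proof. by case/andP: p01. Qed.

(** A supporting linear form, at [t], of the concave function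
    [(\sum_k t k `^ p) `^ p^-1] on the positive orthant; [lam] is its
    gradient. *)
Lemma lp_tangent n (t : 'I_n -> R) : (forall k, 0 < t k) ->
  exists2 lam : 'I_n -> R, (forall k, 0 <= lam k) &
    (\sum_k lam k * t k) `^ p = \sum_k t k `^ p /\
    forall tau : 'I_n -> R, (forall k, 0 <= tau k) ->
      \sum_k tau k `^ p <= (\sum_k lam k * tau k) `^ p.
Proof.
move=> t0; pose S := \sum_k t k `^ p.
have S0 : 0 <= S by apply: sumr_ge0 => k _; rewrite powR_ge0.
have [n0|/card_gt0P[k0 _]] := posnP #|'I_n|.
  exists (fun=> 0) => //; split=> [|tau _]; rewrite !big1 ?powR0 ?gt_eqF//;
    by move=> k; have := fintype0 k n0.
have Sgt0 : 0 < S.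
  rewrite /S (bigD1 k0)//= ltr_pwDl ?powR_gt0// sumr_ge0// => k _.
  by rewrite powR_ge0.
pose M := S `^ p^-1; have M0 : 0 < M by rewrite powR_gt0.
have MX : M `^ p = S by rewrite (powRpK p01).
have tX k : t k `^ (p - 1) * t k = t k `^ p.
  by rewrite mulrC mulr_powRB1// ltW.
exists (fun k => M `^ (1 - p) * t k `^ (p - 1)) => [k|].
  by rewrite mulr_ge0 ?powR_ge0.
split=> [|tau tau0].
  under eq_bigr do rewrite -mulrA tX.
  rewrite -mulr_sumr -/S -MX -powRD ?subrK ?powRr1 ?(ltW M0)//.
  by rewrite gt_eqF ?implybT.
set L := \sum_k (M `^ (1 - p) * t k `^ (p - 1) * tau k).
have L0 : 0 <= L.
  by apply: sumr_ge0 => k _; rewrite !mulr_ge0 ?powR_ge0.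
have [L00|Ln0] := eqVneq L 0.
  rewrite L00 powR0 ?gt_eqF// big1// => k _.
  have /eqP := L00; rewrite psumr_eq0 => [|i _]; last by rewrite !mulr_ge0 ?powR_ge0.
  move=> /allP/(_ k (mem_index_enum _)); rewrite !mulf_eq0.
  rewrite (gt_eqF (powR_gt0 _ M0)) (gt_eqF (powR_gt0 _ (t0 k)))/= => /eqP ->.
  by rewrite powR0// gt_eqF.
have Lgt0 : 0 < L by rewrite lt_neqAle eq_sym Ln0.
(* The tangent inequality for the power at [t k * (L / M)]: the dilation of
   [t] by [L / M] takes the same value as [tau] under the linear form. *)
have term k : tau k `^ p <= L `^ p * (p / L * (M `^ (1 - p) * t k `^ (p - 1) * tau k)
    + (1 - p) / S * t k `^ p).
  have Sn0 : S != 0 by rewrite gt_eqF.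
  have tn0 : t k != 0 by rewrite gt_eqF.
  have Mn0 : M != 0 by rewrite gt_eqF.
  have -> : M `^ (1 - p) = M / S.
    by rewrite powRB ?powRr1 ?(ltW M0)// ?MX// Mn0 implybT.
  have -> : t k `^ (p - 1) = t k `^ p / t k by rewrite -tX mulfK.
  pose z := tau k * M / (L * t k).
  have z0 : 0 <= z by rewrite divr_ge0 ?mulr_ge0 ?(ltW M0) ?(ltW (t0 k)).
  have -> : tau k = z * (L * t k / M) by rewrite /z; field; rewrite Mn0 tn0.
  have LtM : 0 <= L * t k / M by rewrite divr_ge0 ?mulr_ge0 ?(ltW M0) ?(ltW (t0 k)).
  rewrite powRM// powRM ?mulr_ge0 ?invr_ge0 ?(ltW M0) ?(ltW (t0 k))//.
  rewrite powRM ?(ltW (t0 k))// -powR_inv1 ?(ltW M0)// powRAC MX powR_inv1//.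
  have pp : 0 <= p <= 1 by rewrite !ltW.
  have w0 : 0 <= L `^ p * t k `^ p * S^-1 by rewrite !mulr_ge0 ?powR_ge0 ?invr_ge0.
  apply: le_trans (ler_wpM2r w0 (powR_le_tangent pp z0)) _.
  rewrite (powR_inv1 (ltW M0)) le_eqVlt; apply/orP; left; apply/eqP.
  by field; rewrite Mn0 tn0 Sn0 Ln0.
apply: le_trans (ler_sum _ (fun k _ => term k)) _.
rewrite -mulr_sumr big_split/= -!mulr_sumr -/L -/S.
by rewrite !mulfVK ?gt_eqF// addrC subrK mulr1.
Qed.

End PowerSums.

Section Krivine.
Context {R : realType}.

Lemma krivine_coord n (i : 'I_n) :
  krivine_fun (fun t : 'rV[R]_n => t ord0 i).
Proof.
by split=> [|a t _]; [exact: coord_continuous|rewrite mxE].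
Qed.

Lemma krivine0 n : krivine_fun (fun _ : 'rV[R]_n => 0).
Proof. by split=> [t|a t _]; [exact: cst_continuous|rewrite mulr0]. Qed.

Lemma krivine_lin n (a : R) (g h : 'rV[R]_n -> R) :
  krivine_fun g -> krivine_fun h -> krivine_fun (fun t => a * g t + h t).
Proof.
move=> [gc gh] [hc hh]; split=> [t|b t b0]; last by rewrite gh// hh// mulrDr mulrCA.
apply: (@continuousD _ _ _ (fun t => a * g t) h); last exact: hc.
by apply: (@continuousM _ _ (cst a) g); [exact: cst_continuous|exact: gc].
Qed.

Lemma krivine_abs n (i : 'I_n) : krivine_fun (fun t : 'rV[R]_n => `|t ord0 i|).
Proof.
split=> [t|a t a0]; last by rewrite mxE normrM ger0_norm.
apply: (@continuous_comp _ _ _ (fun t : 'rV[R]_n => t ord0 i) (fun u : R => `|u|)).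
  exact: coord_continuous.
exact: norm_continuous.
Qed.

Lemma powR_norm_continuous (q : R) : 0 < q -> continuous (fun x : R => `|x| `^ q).
Proof.
move=> q0 x; have [->|x0] := eqVneq x 0.
  apply/cvgrPdist_lt => e e0; rewrite normr0 powR0 ?gt_eqF//.
  have d0 : 0 < e `^ q^-1 by rewrite powR_gt0.
  near=> y; rewrite sub0r normrN ger0_norm ?powR_ge0//.
  have ye : `|y| < e `^ q^-1 by near: y; exact: (@nbhs0_lt R R).
  have eX : (e `^ q^-1) `^ q = e.
    by rewrite -powRrM mulVf ?gt_eqF// powRr1 ?ltW.
  by rewrite -[ltRHS]eX gt0_ltr_powR ?nnegrE ?(ltW d0).
apply: (@continuous_comp R R R (fun y => `|y|) (fun y => y `^ q)).
  exact: norm_continuous.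
apply: differentiable_continuous; apply/derivable1_diffP.
by apply: derivable_powR; rewrite in_itv/= andbT normr_gt0.
Unshelve. all: by end_near.
Qed.

Lemma krivine_lp n (p : R) : 0 < p -> krivine_fun (@lp_fun R p n).
Proof.
move=> p0; split=> [t|a t a0].
  pose f (u : 'rV[R]_n) := \sum_(k < n) `|u ord0 k| `^ p.
  have -> : @lp_fun R p n = (fun u : R => `|u| `^ p^-1) \o f.
    apply/funext => u; rewrite /lp_fun/=; congr (_ `^ _); apply/esym/ger0_norm.
    by apply: sumr_ge0 => k _; rewrite powR_ge0.
  apply: (@continuous_comp _ _ _ f (fun u : R => `|u| `^ p^-1)); last first.
    by apply: powR_norm_continuous; rewrite invr_gt0.
  apply: continuous_big => [|k _ {}t]; first exact: add_continuous.
  apply: (@continuous_comp _ _ _ (fun t : 'rV[R]_n => t ord0 k) (fun u : R => `|u| `^ p)).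
    exact: coord_continuous.
  exact: powR_norm_continuous.
rewrite /lp_fun; under eq_bigr do rewrite mxE normrM (ger0_norm a0) powRM//.
rewrite -mulr_sumr powRM ?powR_ge0 ?sumr_ge0//.
by rewrite -powRrM mulfV ?gt_eqF// powRr1.
Qed.

Section Calculus.
Variables (X : quasiBanachLatticeType R) (n : nat) (x : 'I_n -> X)
  (Phi : ('rV[R]_n -> R) -> X).
Hypothesis calc : krivine_calculus x Phi.

Lemma krivine_calculus_le g h : krivine_fun g -> krivine_fun h ->
  (forall t, g t <= h t) -> Phi g <= Phi h.
Proof.
case: calc => _ _ Pmax _ kg kh gh; have := Pmax g h kg kh.
have -> : (fun t => Num.max (g t) (h t)) = h.
  by apply/funext => t; rewrite max_r.
by move=> ->; exact: vjoin_ubl.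
Qed.

Lemma krivine_calculus0 : Phi (fun=> 0) = 0.
Proof.
case: calc => _ Plin _ _; have := Plin 1 _ _ (krivine0 n) (krivine0 n).
have -> : (fun t : 'rV[R]_n => 1 * 0 + 0) = (fun=> 0) :> ('rV[R]_n -> R).
  by apply/funext => t; rewrite mulr0 addr0.
by rewrite scale1r -[LHS]addr0 => /addrI.
Qed.

Lemma krivine_calculus_abs i : Phi (fun t => `|t ord0 i|) = labs (x i).
Proof.
case: calc => Pcoord Plin Pmax _.
have kN := krivine_lin (-1) (krivine_coord i) (krivine0 n).
have := Pmax _ _ (krivine_coord i) kN.
rewrite Plin//; [|exact: krivine_coord|exact: krivine0].
rewrite Pcoord krivine_calculus0 addr0 scaleN1r -/(labs (x i)) => <-.
by congr Phi; apply/funext => t; rewrite addr0 mulN1r maxrN.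
Qed.

Lemma krivine_calculus_sum (lam : 'I_n -> R) (r : seq 'I_n) :
  krivine_fun (fun t => \sum_(k <- r) lam k * `|t ord0 k|) /\
  Phi (fun t => \sum_(k <- r) lam k * `|t ord0 k|) = \sum_(k <- r) lam k *: labs (x k).
Proof.
elim: r => [|k r [kr Pr]].
  have -> : (fun t : 'rV[R]_n => \sum_(k <- [::]) lam k * `|t ord0 k|) = (fun=> 0).
    by apply/funext => t; rewrite big_nil.
  by rewrite big_nil krivine_calculus0; split=> //; exact: krivine0.
have -> : (fun t : 'rV[R]_n => \sum_(j <- k :: r) lam j * `|t ord0 j|) =
    (fun t => lam k * `|t ord0 k| + \sum_(j <- r) lam j * `|t ord0 j|).
  by apply/funext => t; rewrite big_cons.
split; first by apply: krivine_lin => //; exact: krivine_abs.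
case: calc => _ Plin _ _.
by rewrite Plin//; [rewrite krivine_calculus_abs Pr big_cons|exact: krivine_abs].
Qed.

(** The calculus preserves inequalities, and evaluates linear combinations of
    absolute values as expected. So the [lp_fun] of the [x k] is bounded by the
    supporting linear forms of [lp_fun], in particular by the one at the values
    of the [x k] at the point. *)
Lemma krivine_lp_le (p : R) : 0 < p < 1 ->
  \forall_points c, `|c (Phi (@lp_fun R p n))| `^ p <= \sum_k `|c (x k)| `^ p.
Proof.
move=> p01; have /andP[p0 p1] := p01; near=> c.
have wlp : within (unit_of c) (Phi (@lp_fun R p n)) by near: c; exact: near_within.
have wx : forall k, within (unit_of c) (x k).
  by near: c; apply: filter_forall => k; exact: near_within.
have wlx k : within (unit_of c) (labs (x k)).
  by apply: within_solid (wx k); rewrite labs_id.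
have lp0 : 0 <= c (Phi (@lp_fun R p n)).
  rewrite -(ev0 c) ev_le//; first exact: within0.
  rewrite -krivine_calculus0; apply: krivine_calculus_le => [||t].
  - exact: krivine0.
  - exact: krivine_lp.
  - exact: powR_ge0.
rewrite ger0_norm//; apply/ler_addgt0Pr => e e0.
(* The supporting form exists at positive arguments only, hence a small
   shift of the values of the [x k]. *)
pose eta : R := (e / n.+1%:R) `^ p^-1.
have en0 : 0 < e / n.+1%:R by rewrite divr_gt0.
have eta0 : 0 < eta by rewrite powR_gt0.
have etaX : eta `^ p = e / n.+1%:R by rewrite (powRpK p01) ?(ltW en0).
pose t k := `|c (x k)| + eta.
have t0 k : 0 < t k by rewrite ltr_wpDl.
have [lam lam0 [lamt lamle]] := lp_tangent p01 t0.
apply: (@le_trans _ _ (\sum_k t k `^ p)).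
  rewrite -lamt ge0_ler_powR ?nnegrE ?(ltW p0)//.
    by apply: sumr_ge0 => k _; rewrite mulr_ge0 ?(ltW (t0 k)).
  have [ksum Psum] := krivine_calculus_sum lam (index_enum 'I_n).
  have wsum : within (unit_of c) (\sum_k lam k *: labs (x k)).
    by apply: within_sum => k; apply: withinZ.
  apply: (@le_trans _ _ (c (\sum_k lam k *: labs (x k)))).
    rewrite ev_le// -Psum; apply: krivine_calculus_le => [|//|u].
      exact: krivine_lp.
    rewrite /lp_fun; have ta0 k : 0 <= `|u ord0 k| by [].
    have := lamle _ ta0 => /(ge0_ler_powR (_ : 0 <= p^-1)).
    rewrite invr_ge0 (ltW p0) !nnegrE powR_ge0 sumr_ge0; last by move=> k _; rewrite powR_ge0.
    rewrite (powRKp p01); first by apply.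
    by apply: sumr_ge0 => k _; rewrite mulr_ge0.
  rewrite ev_sum => [|k]; last exact: withinZ.
  apply: ler_sum => k _; rewrite evZ// ev_labs// ler_wpM2l// lerDl ltW//.
apply: (@le_trans _ _ (\sum_k (`|c (x k)| `^ p + e / n.+1%:R))).
  apply: ler_sum => k _; rewrite -etaX.
  by apply: powRD_le; rewrite ?p0 ?(ltW p1) ?(ltW eta0).
rewrite big_split/= lerD2l sumr_const card_ord -[_ *+ n]mulr_natl mulrCA.
rewrite ler_piMr ?(ltW e0)//.
by rewrite ler_pdivrMr ?ltr0n// mul1r ler_nat.
Unshelve. all: by end_near.
Qed.

End Calculus.
End Krivine.

Theorem corollary5p9 (R : realType) (E : quasiBanachType R)
    (F : quasiBanachLatticeType R) (delta : {linear E -> F})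
    (hE : natural E) (hF : is_FQBL delta) (p : R)
    (hp : 0 < p < p_nat E) :
  s_convex p F.
Proof.
have /andP[p0 pE] := hp.
have [s [ps s1 Es]] : exists s, [/\ p < s, s < 1 & is_snorm s E].
  have nonempty : [set s : R | 0 < s < 1 /\ s_natural s E] !=set0.
    apply/set0P/eqP => h; move: pE; rewrite /p_nat h sup0; lra.
  have [s [/andP[_ s1] [_ [X [J [Xs _ _ Jiso]]]]] ps] := sup_gt nonempty pE.
  exists s; split=> // x y; rewrite -!Jiso raddfD; exact: Xs.
have p01 : 0 < p < 1 by rewrite p0 (lt_trans ps).
have [FL _ delta_iso univ] := hF.
have pb : power_bounded delta p.
  by split=> //; exact: (power_ball_bounded p01 ps Es delta_iso FL).
have [T [[Tcont Tjoin Tmeet] Tdelta _ _]] :=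
  univ (power_space pb) (power_embedding pb) (power_space_L_convex pb)
    (power_embedding_continuous pb).
pose S : {linear F -> F} := (\val : {linear power_space pb -> F}) \o T.
have [vcont vjoinP vmeetP] := power_space_val_lattice_hom pb.
have Shom : lattice_hom S.
  split=> [x e e0|x y|x y]; last 2 first.
  - by rewrite /S/= Tjoin.
  - by rewrite /S/= Tmeet.
  have [d d0 Hd] := vcont (T x) e e0; have [d' d'0 Hd'] := Tcont x d d0.
  by exists d' => // y /Hd' /Hd.
have delta_cont : qcontinuous delta.
  by move=> x e e0; exists e => // y; rewrite -raddfB delta_iso.
have [U [_ _ Uuniq _]] := univ F delta FL delta_cont.
(* Both [S] and the identity extend [delta]. *)
have Sid f : \val (T f) = f.
  have -> : \val (T f) = S f by [].
  have idhom : lattice_hom (idfun : {linear F -> F}).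
    by split=> // x e e0; exists e.
  rewrite (Uuniq S Shom) => [|e]; last by rewrite /S/= Tdelta.
  by rewrite -(Uuniq idfun idhom).
have [d d0 Td] := Tcont 0 1 ltr01.
have gauge_small f : qnorm f < d -> power_ball delta p 1 [:: f].
  move=> fd; have := Td f; rewrite (linear0 T) !subr0 => /(_ fd) h.
  rewrite -(Sid f); apply: (gauge_lt (valP (T f))).
  have one : 1 `^ p = 1 :> R by rewrite powR1.
  by rewrite -qnorm_power -one gt0_ltr_powR ?nnegrE ?qnorm_ge0.
(* The factor 2 keeps the rescaled element strictly inside the neighbourhood
   of 0 given by [gauge_small]. *)
have ball_norm f : power_ball delta p ((2 / d) `^ p * qnorm f `^ p) [:: f].
  have [f0|f0] := eqVneq (qnorm f) 0.
    rewrite (qnorm_eq0 _ f0) qnorm0 [0 `^ p]powR0 ?gt_eqF// mulr0.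
    have B0 : power_ball delta p 1 [:: 0] by apply: gauge_small; rewrite qnorm0.
    by have := power_ballZ 0 B0; rewrite scale0r normr0 powR0 ?mul0r// gt_eqF.
  have qf : 0 < qnorm f by rewrite lt_neqAle eq_sym f0 qnorm_ge0.
  pose a := 2 / d * qnorm f; have a0 : 0 < a by rewrite mulr_gt0 ?divr_gt0.
  have : power_ball delta p 1 [:: a^-1 *: f].
    apply: gauge_small; rewrite qnormZ gtr0_norm ?invr_gt0// ltr_pdivrMl//.
    by rewrite /a mulrAC divfK ?gt_eqF// mulrC ltr_pMr// ltr1n.
  move=> /(power_ballZ a); rewrite scalerA mulfV ?gt_eqF// scale1r mulr1.
  by rewrite gtr0_norm// /a powRM ?qnorm_ge0 ?divr_ge0 ?(ltW d0).
have [K K0 HK] := finite_qnorm_le pb.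
split=> //; exists (K * (2 / d)); split; first by rewrite mulr_gt0 ?divr_gt0.
move=> n x Phi calc; set f := Phi _; set Q := \sum_k _.
have Q0 : 0 <= Q by apply: sumr_ge0 => k _; rewrite powR_ge0.
have Bf : power_ball delta p ((2 / d) `^ p * Q) [:: f].
  rewrite /Q mulr_sumr.
  apply: (power_ball_le (power_ball_sum p01 (index_enum 'I_n) (fun k => ball_norm (x k)))).
  apply: filterS (krivine_lp_le calc p01) => c.
  by rewrite /power_sum big_seq1 big_map.
have ff : f \in finite_gauge pb by apply/finiteP; exists ((2 / d) `^ p * Q).
apply: le_trans (HK f ff) _; rewrite -mulrA ler_wpM2l ?(ltW K0)//.
have d2 : 0 <= 2 / d by rewrite divr_ge0 ?(ltW d0).
rewrite -[2 / d](powRKp p01)// -powRM ?powR_ge0//.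
rewrite ge0_ler_powR ?nnegrE ?gauge_ge0 ?mulr_ge0 ?powR_ge0 ?invr_ge0 ?(ltW p0)//.
exact: gauge_le.
Qed.
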